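(* Let $E/F$ be a totally ramified cubic field extension of non-Archimedean local fields and let $R$ be an order of $E$. Let $s=S(R)$ and let $f=f(R)$ be the conductor exponent of $R$. Then $\#\overline{\mathrm{Cl}}(R)$ depends only on $s$, $f$ and $q$, and is given as follows. If $3\mid f$, $$\#\overline{\mathrm{Cl}}(R)=\begin{cases} \dfrac{q^{\frac s2+2}+9q^{\frac s2+1}+2q^{\frac s2}+2sq^{\frac f6}(1-q)-8q^{\frac f6+1}-3q^{s-\frac f3+1}-q^{s-\frac f3}}{q^{\frac f6}(q-1)^2} & s\text{ even},\ \frac f3\text{ even};\\[1.2em] \dfrac{5q^{\frac s2+1}+7q^{\frac s2}+2sq^{\frac{f-3}6}(1-q)-8q^{\frac{f+3}6}-q^{s-\frac f3+1}-3q^{s-\frac f3}}{q^{\frac{f-3}6}(q-1)^2} & s\text{ even},\ \frac f3\text{ odd};\\[1.2em] \dfrac{5q^{\frac{s+3}2}+7q^{\frac{s+1}2}+2sq^{\frac f6}(1-q)-8q^{\frac f6+1}-3q^{s-\frac f3+1}-q^{s-\frac f3}}{q^{\frac f6}(q-1)^2} & s\text{ odd},\ \frac f3\text{ even};\\[1.2em] \dfrac{q^{\frac{s+3}2}+9q^{\frac{s+1}2}+2q^{\frac{s-1}2}+2sq^{\frac{f-3}6}(1-q)-8q^{\frac{f+3}6}-q^{s-\frac f3+1}-3q^{s-\frac f3}}{q^{\frac{f-3}6}(q-1)^2} & s\text{ odd},\ \frac f3\text{ odd}. \end{cases}$$ If $3\mid(f+1)$, $$\#\overline{\mathrm{Cl}}(R)=\begin{cases}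 \dfrac{2q^{\frac s2+2}+9q^{\frac s2+1}+q^{\frac s2}+2sq^{\frac{f+1}6}(1-q)-8q^{\frac{f+1}6+1}-q^{s-\frac{f+1}3+2}-3q^{s-\frac{f+1}3+1}}{q^{\frac{f+1}6}(q-1)^2} & s\text{ even},\ \frac{f+1}3\text{ even};\\[1.2em] \dfrac{7q^{\frac s2+1}+5q^{\frac s2}+2sq^{\frac{f-2}6}(1-q)-8q^{\frac{f+4}6}-3q^{s-\frac{f+1}3+1}-q^{s-\frac{f+1}3}}{q^{\frac{f-2}6}(q-1)^2} & s\text{ even},\ \frac{f+1}3\text{ odd};\\[1.2em] \dfrac{7q^{\frac{s+3}2}+5q^{\frac{s+1}2}+2sq^{\frac{f+1}6}(1-q)-8q^{\frac{f+1}6+1}-q^{s-\frac{f+1}3+2}-3q^{s-\frac{f+1}3+1}}{q^{\frac{f+1}6}(q-1)^2} & s\text{ odd},\ \frac{f+1}3\text{ even};\\[1.2em] \dfrac{2q^{\frac{s+3}2}+9q^{\frac{s+1}2}+q^{\frac{s-1}2}+2sq^{\frac{f-2}6}(1-q)-8q^{\frac{f+4}6}-3q^{s-\frac{f+1}3+1}-q^{s-\frac{f+1}3}}{q^{\frac{f-2}6}(q-1)^2} & s\text{ odd},\ \frac{f+1}3\text{ odd}. \end{cases}$$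
   Context: $F$ is a non-Archimedean local field of any characteristic, with ring of integers $\mathfrak o$ and residue field of cardinality $q$. $\mathcal O_E$ is the ring of integers of $E$ and $\pi_E$ a uniformizer of $E$. An order of $E$ is a subring $\mathcal O\subset E$ containing $\mathfrak o$, finitely generated as an $\mathfrak o$-module, with $F\mathcal O=E$. $S(R)$ is the length of $\mathcal O_E/R$ as an $\mathfrak o$-module. The conductor exponent $f(R)\ge0$ is defined by $\{a\in\mathcal O_E: a\mathcal O_E\subset R\}=\pi_E^{f(R)}\mathcal O_E$; the case $f(R)\equiv1\pmod 3$ does not occur. A fractional $R$-ideal is a nonzero finitely generated $R$-submodule of $E$; $\overline{\mathrm{Cl}}(R)$ is the set (monoid) of fractional $R$-ideals modulo multiplication by $E^\times$. *)

(* Defs.v *)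
From HB Require Import structures.
From mathcomp Require Import all_boot all_order all_algebra all_field.
From mathcomp Require Import all_classical.

Set Implicit Arguments.
Unset Strict Implicit.
Unset Printing Implicit Defensive.

Import Order.TTheory GRing.Theory Num.Theory.
Local Open Scope classical_set_scope.
Local Open Scope ring_scope.

(* A discrete valuation is a map [v : K -> int]; its value at 0 (which should
   be +oo) is irrelevant, so that every use of [v] is restricted to nonzero
   arguments. *)
Section LocalField.
Variables (K : fieldType) (v : K -> int).

Definition val_ge (n : int) : set K := [set x | x = 0 \/ n <= v x].

Definition valuation_ring : set K := val_ge 0.

Definition residue_field : set (set K) :=
  [set [set x + y | y in val_ge 1] | x in valuation_ring].

Definition val_cauchy (u : nat -> K) : Prop :=
  forall n : int, exists k : nat, forall i j : nat,
    (k <= i)%N -> (k <= j)%N -> val_ge n (u i - u j).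

Definition val_cvg (u : nat -> K) (l : K) : Prop :=
  forall n : int, exists k : nat, forall i : nat,
    (k <= i)%N -> val_ge n (u i - l).

(* [v] is the normalized (surjective) discrete valuation of the
   non-Archimedean local field [K]. *)
Record local_field : Prop := LocalField {
  local_valM : forall x y, x != 0 -> y != 0 -> v (x * y) = v x + v y;
  local_valD : forall x y, x != 0 -> y != 0 -> x + y != 0 ->
    Num.min (v x) (v y) <= v (x + y);
  local_val1 : exists2 x, x != 0 & v x = 1;
  local_complete : forall u, val_cauchy u -> exists l, val_cvg u l;
  local_finite : finite_set residue_field }.

Definition uniformizer (x : K) : Prop := x != 0 /\ v x = 1.

End LocalField.

Section Modules.
Variable K : fieldType.
Implicit Types (A X M N : set K).

Definition lin_span A X : set K :=
  [set x | exists (n : nat) (a g : 'I_n -> K),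
     [/\ forall i, A (a i), forall i, X (g i) & x = \sum_(i < n) a i * g i]].

Definition submodule A M : Prop :=
  [/\ M 0, forall x y, M x -> M y -> M (x + y)
    & forall a x, A a -> M x -> M (a * x)].

Definition finitely_generated A M : Prop :=
  exists s : seq K, M = lin_span A [set` s].

(* Submodules of M / N are encoded as submodules of M containing N. *)
Definition quotient_chain A N M (n : nat) : Prop :=
  exists C : nat -> set K,
    (forall i, (i <= n)%N -> [/\ submodule A (C i), N `<=` C i & C i `<=` M])
    /\ (forall i, (i < n)%N -> C i `<` C i.+1).

(* M / N has length n over A. *)
Definition quotient_length A N M (n : nat) : Prop :=
  quotient_chain A N M n /\ forall m, quotient_chain A N M m -> (m <= n)%N.

Definition fractional_ideal A : set (set K) :=
  [set I | [/\ submodule A I, finitely_generated A I & I <> [set 0]]].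

Definition ideal_class M : set (set K) :=
  [set J | exists2 c : K, c != 0 & J = [set c * x | x in M]].

Definition ideal_class_monoid A : set (set (set K)) :=
  [set ideal_class I | I in fractional_ideal A].

End Modules.

Section Extension.
Variables (F : fieldType) (E : fieldExtType F).
Variables (v : F -> int) (w : E -> int).

(* For normalized valuations, [w] extends [v] with ramification index [e]. *)
Definition ramification_index (e : nat) : Prop :=
  forall a : F, a != 0 -> w a%:A = e%:Z * v a.

Definition totally_ramified : Prop := ramification_index (\dim {:E}).

Definition base_ring : set E := [set a%:A | a in valuation_ring v].

Definition is_order (R : set E) : Prop :=
  [/\ GRing.subring_closed (mem R), base_ring `<=` R,
      finitely_generated base_ring R
    & lin_span [set a%:A | a in [set: F]] R = [set: E]].

Definition colength (R : set E) (s : nat) : Prop :=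
  quotient_length base_ring R (valuation_ring w) s.

Definition conductor_exponent (piE : E) (R : set E) (f : nat) : Prop :=
  [set a | valuation_ring w a /\
           [set a * b | b in valuation_ring w] `<=` R]
  = [set piE ^+ f * b | b in valuation_ring w].

End Extension.

(* In each case below every natural number division is exact and the natural
   number subtractions do not truncate. *)
Definition card_formula_3f (q s f : nat) : rat :=
  let Q : rat := q%:R in
  let S : rat := s%:R in
  let d : int := s%:Z - (f %/ 3)%N%:Z in
  match odd s, odd (f %/ 3) with
  | false, false =>
      (Q ^+ (s %/ 2 + 2) + 9 * Q ^+ (s %/ 2 + 1) + 2 * Q ^+ (s %/ 2)
       + 2 * S * Q ^+ (f %/ 6) * (1 - Q) - 8 * Q ^+ (f %/ 6 + 1)
       - 3 * Q ^ (d + 1) - Q ^ d)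
      / (Q ^+ (f %/ 6) * (Q - 1) ^+ 2)
  | false, true =>
      (5 * Q ^+ (s %/ 2 + 1) + 7 * Q ^+ (s %/ 2)
       + 2 * S * Q ^+ ((f - 3) %/ 6) * (1 - Q) - 8 * Q ^+ ((f + 3) %/ 6)
       - Q ^ (d + 1) - 3 * Q ^ d)
      / (Q ^+ ((f - 3) %/ 6) * (Q - 1) ^+ 2)
  | true, false =>
      (5 * Q ^+ ((s + 3) %/ 2) + 7 * Q ^+ ((s + 1) %/ 2)
       + 2 * S * Q ^+ (f %/ 6) * (1 - Q) - 8 * Q ^+ (f %/ 6 + 1)
       - 3 * Q ^ (d + 1) - Q ^ d)
      / (Q ^+ (f %/ 6) * (Q - 1) ^+ 2)
  | true, true =>
      (Q ^+ ((s + 3) %/ 2) + 9 * Q ^+ ((s + 1) %/ 2) + 2 * Q ^+ ((s - 1) %/ 2)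
       + 2 * S * Q ^+ ((f - 3) %/ 6) * (1 - Q) - 8 * Q ^+ ((f + 3) %/ 6)
       - Q ^ (d + 1) - 3 * Q ^ d)
      / (Q ^+ ((f - 3) %/ 6) * (Q - 1) ^+ 2)
  end.

Definition card_formula_3f1 (q s f : nat) : rat :=
  let Q : rat := q%:R in
  let S : rat := s%:R in
  let d : int := s%:Z - ((f + 1) %/ 3)%N%:Z in
  match odd s, odd ((f + 1) %/ 3) with
  | false, false =>
      (2 * Q ^+ (s %/ 2 + 2) + 9 * Q ^+ (s %/ 2 + 1) + Q ^+ (s %/ 2)
       + 2 * S * Q ^+ ((f + 1) %/ 6) * (1 - Q) - 8 * Q ^+ ((f + 1) %/ 6 + 1)
       - Q ^ (d + 2) - 3 * Q ^ (d + 1))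
      / (Q ^+ ((f + 1) %/ 6) * (Q - 1) ^+ 2)
  | false, true =>
      (7 * Q ^+ (s %/ 2 + 1) + 5 * Q ^+ (s %/ 2)
       + 2 * S * Q ^+ ((f - 2) %/ 6) * (1 - Q) - 8 * Q ^+ ((f + 4) %/ 6)
       - 3 * Q ^ (d + 1) - Q ^ d)
      / (Q ^+ ((f - 2) %/ 6) * (Q - 1) ^+ 2)
  | true, false =>
      (7 * Q ^+ ((s + 3) %/ 2) + 5 * Q ^+ ((s + 1) %/ 2)
       + 2 * S * Q ^+ ((f + 1) %/ 6) * (1 - Q) - 8 * Q ^+ ((f + 1) %/ 6 + 1)
       - Q ^ (d + 2) - 3 * Q ^ (d + 1))
      / (Q ^+ ((f + 1) %/ 6) * (Q - 1) ^+ 2)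
  | true, true =>
      (2 * Q ^+ ((s + 3) %/ 2) + 9 * Q ^+ ((s + 1) %/ 2) + Q ^+ ((s - 1) %/ 2)
       + 2 * S * Q ^+ ((f - 2) %/ 6) * (1 - Q) - 8 * Q ^+ ((f + 4) %/ 6)
       - 3 * Q ^ (d + 1) - Q ^ d)
      / (Q ^+ ((f - 2) %/ 6) * (Q - 1) ^+ 2)
  end.

(* Main.v *)
Require Import Defs.
From HB Require Import structures.
From mathcomp Require Import all_boot all_order all_algebra all_field.
From mathcomp Require Import all_classical.
From mathcomp Require Import zify ring.

Set Implicit Arguments.
Unset Strict Implicit.
Unset Printing Implicit Defensive.

Import Order.TTheory GRing.Theory Num.Theory.
Local Open Scope classical_set_scope.
Local Open Scope card_scope.
Local Open Scope ring_scope.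

(* Write o for the ring of integers of F, p for a uniformizer of F and pi for one
   of E. Up to E^*, a lattice M contains 1 and lies in O_E. Taking an element of M
   of least valuation prime to 3, one writes it as
     M = o + o p^i (rho + b sig) + o p^j sig,   i <= j,  b in o mod p^(j - i),
   with (rho, sig) = (pi, pi^2) (type t = 0) or (pi^2, p pi) (type t = 1).
   Put g = p^a (rho + b sig). If j <= 2i then M is the order o + p^n o[g] with
   a = j - i, n = 2i - j. If j > 2i then M = o + o g + p^n o g^2 with a = i,
   n = j - 2i: it is homothetic to the dual of the order o + p^n o[g], which is
   its multiplier ring, and it is not principal. Hence each overorder R' of R is
   the multiplier ring of one class of ideals if n = 0 (R' is Gorenstein) and of
   two classes if n > 0, so that the classes can be counted by the overorders.
   The type, i and j of R are determined by s = i + j + t and f = 3j + 2t, and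
   inclusion between two lattices in normal form is a condition on (t, i, j, b),
   so that the number of overorders is a sum of powers of q. *)

(** * Discrete valuations *)

(** Lets equivalent propositions be rewritten inside [[/\ _, _ & _]], the shape of membership in a
    lattice. *)
#[local] Instance and3_iff_proper : Morphisms.Proper
  (Morphisms.respectful iff (Morphisms.respectful iff
    (Morphisms.respectful iff iff))) and3.
Proof. by move=> A A' hA B B' hB C C' hC; split=> -[/hA ? /hB ? /hC ?]. Qed.

Section Valuation.
Variables (K : fieldType) (v : K -> int).
Hypothesis lf : local_field v.
Implicit Types (x y a : K) (m n : int).

Lemma dvalM x y : x != 0 -> y != 0 -> v (x * y) = v x + v y.
Proof. exact: local_valM lf _ _. Qed.

Lemma dvalD x y : x != 0 -> y != 0 -> x + y != 0 ->
  Num.min (v x) (v y) <= v (x + y).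
Proof. exact: local_valD lf _ _. Qed.

Lemma dval1 : v 1 = 0.
Proof.
have n1 : (1 : K) != 0 by exact: oner_neq0.
have := dvalM n1 n1; rewrite mulr1; lia.
Qed.

Lemma dvalN x : v (- x) = v x.
Proof.
have [->|x0] := eqVneq x 0; first by rewrite oppr0.
have N1 : (-1 : K) != 0 by rewrite oppr_eq0 oner_neq0.
have := dvalM N1 N1; rewrite mulrNN mulr1 dval1 => e.
by rewrite -mulN1r dvalM //; lia.
Qed.

Lemma dvalV x : x != 0 -> v x^-1 = - v x.
Proof.
move=> x0; have := dvalM x0 (invr_neq0 x0).
by rewrite mulfV // dval1; lia.
Qed.

Lemma dvalX x (k : nat) : x != 0 -> v (x ^+ k) = k%:Z * v x.
Proof.
move=> x0; elim: k => [|k IHk]; first by rewrite expr0 dval1 mul0r.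
by rewrite exprS dvalM ?expf_neq0 // IHk; lia.
Qed.

Lemma val_geP n x : x != 0 -> val_ge v n x <-> n <= v x.
Proof. by move=> x0; split => [[/eqP|//]|]; [rewrite (negPf x0)|right]. Qed.

Lemma val_ge0 n : val_ge v n 0.
Proof. by left. Qed.

Lemma val_ge_le m n x : m <= n -> val_ge v n x -> val_ge v m x.
Proof. by move=> mn [->|nx]; [left|right; lia]. Qed.

Lemma val_geN n x : val_ge v n (- x) <-> val_ge v n x.
Proof.
have H y : val_ge v n y -> val_ge v n (- y).
  by case=> [->|h]; [left; rewrite oppr0 | right; rewrite dvalN].
by split => /H //; rewrite opprK.
Qed.

Lemma val_geD n x y : val_ge v n x -> val_ge v n y -> val_ge v n (x + y).
Proof.
move=> hx hy; have [xy|xy] := eqVneq (x + y) 0; first by left.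
have [x0|x0] := eqVneq x 0; first by rewrite x0 add0r.
have [y0|y0] := eqVneq y 0; first by rewrite y0 addr0.
move/val_geP: hx => /(_ x0) hx; move/val_geP: hy => /(_ y0) hy.
by right; have := dvalD x0 y0 xy; lia.
Qed.

Lemma val_geB n x y : val_ge v n x -> val_ge v n y -> val_ge v n (x - y).
Proof. by move=> hx hy; apply: val_geD => //; apply/val_geN. Qed.

Lemma val_geM m n x y : val_ge v m x -> val_ge v n y -> val_ge v (m + n) (x * y).
Proof.
move=> hx hy; have [->|x0] := eqVneq x 0; first by left; rewrite mul0r.
have [->|y0] := eqVneq y 0; first by left; rewrite mulr0.
move/val_geP: hx => /(_ x0) hx; move/val_geP: hy => /(_ y0) hy.
by right; rewrite dvalM //; lia.
Qed.

Lemma val_ge0M x y : val_ge v 0 x -> val_ge v 0 y -> val_ge v 0 (x * y).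
Proof. by move=> hx hy; have := val_geM hx hy. Qed.

Lemma val_ge1 : val_ge v 0 1.
Proof. by right; rewrite dval1. Qed.

Lemma val_geMl n a x : a != 0 -> val_ge v n (a * x) <-> val_ge v (n - v a) x.
Proof.
move=> a0; have [->|x0] := eqVneq x 0.
  by rewrite mulr0; split=> _; left.
rewrite !val_geP ?mulf_neq0 // dvalM //.
by split => ?; lia.
Qed.

(** Terms of distinct valuations cannot cancel: the sum has the smaller of the two valuations. *)
Lemma val_ge_addl n x y : (x != 0 -> y != 0 -> v x != v y) ->
  val_ge v n (x + y) -> val_ge v n x /\ val_ge v n y.
Proof.
move=> xy h; suff hx : val_ge v n x.
  by split=> //; have := val_geB h hx; rewrite addrAC subrr add0r.
have [->|x0] := eqVneq x 0; first exact: val_ge0.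
have [y0|y0] := eqVneq y 0; first by move: h; rewrite y0 addr0.
have {}xy := xy x0 y0.
have [s0|s0] := eqVneq (x + y) 0.
  by move: xy; rewrite -(addr0_eq s0) dvalN eqxx.
move/val_geP: h => /(_ s0) h.
have [lt|ge] := ltP (v x) (v y); last first.
  right.
  have Ny : - x != 0 by rewrite oppr_eq0.
  have e : (x + y) + - x = y by rewrite addrAC subrr add0r.
  have := dvalD s0 Ny; rewrite e dvalN => /(_ y0).
  by lia.
right; have Ny : - y != 0 by rewrite oppr_eq0.
have := dvalD s0 Ny; rewrite addrK dvalN => /(_ x0).
by lia.
Qed.

Lemma dvalD_min x y : x != 0 -> y != 0 -> v x != v y ->
  x + y != 0 /\ v (x + y) = Num.min (v x) (v y).
Proof.
move=> x0 y0 xy; have s0 : x + y != 0.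
  by apply: contraNneq xy => /addr0_eq <-; rewrite dvalN.
split=> //; have := dvalD x0 y0 s0.
have h : val_ge v (v (x + y)) (x + y) by right.
have [hx hy] := val_ge_addl (fun _ _ => xy) h.
by move/val_geP: hx => /(_ x0); move/val_geP: hy => /(_ y0); lia.
Qed.

Lemma val_geX (k : nat) x : val_ge v 0 x -> val_ge v 0 (x ^+ k).
Proof.
move=> hx; elim: k => [|k IHk]; first exact: val_ge1.
by rewrite exprS; apply: val_ge0M.
Qed.

Lemma val_ge_sum n (I : finType) (f : I -> K) :
  (forall i, val_ge v n (f i)) -> val_ge v n (\sum_i f i).
Proof. by move=> h; elim/big_ind: _ => //; [exact: val_ge0|exact: val_geD]. Qed.

End Valuation.

(** * Auxiliary facts on integers, scalars and finite sets *)

Lemma dvd3D (a b : int) : (3 %| 3 * a + b)%Z = (3 %| b)%Z.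
Proof. lia. Qed.

Lemma dvd3_sub (a b x y : int) : 3 * a + x = 3 * b + y -> (3 %| y - x)%Z.
Proof.
by move=> e; rewrite (_ : y - x = 3 * (a - b)) ?dvdz_mulr //; lia.
Qed.

Lemma int_min (P : int -> Prop) (B : int) : (exists n, P n) ->
  (forall n, P n -> B <= n) -> exists2 n, P n & forall m, P m -> n <= m.
Proof.
move=> [n0 Pn0] lb.
have ex : exists k : nat, `[< P (B + k%:Z) >].
  exists `|n0 - B|%N; apply/asboolP.
  by rewrite (_ : B + _ = n0) //; have := lb _ Pn0; lia.
exists (B + (ex_minn ex)%:Z); first by case: ex_minnP => k /asboolP.
case: ex_minnP => k _ min m Pm.
suff : (k <= `|m - B|)%N by have := lb _ Pm; lia.
apply: min; apply/asboolP.
by rewrite (_ : B + _ = m) //; have := lb _ Pm; lia.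
Qed.

Lemma scale_in_alg (F : fieldType) (E : fieldExtType F) (c : F) (x : E) :
  c *: x = GRing.in_alg E c * x.
Proof. by rewrite in_algE mulr_algl. Qed.

(** Scaling by [c] is multiplication by [in_alg E c], which brings identities in the algebra [E]
    within reach of [ring]. *)
Ltac alg_ring := rewrite !scale_in_alg; ring.

Lemma card_uniq_seq (T : eqType) (s : seq T) : uniq s -> [set` s] #= `I_(size s).
Proof.
case: s => [_|x0 s us].
  rewrite (_ : [set` [::]] = set0); last by rewrite eqEsubset; split.
  by rewrite II0.
apply: card_esym; rewrite (_ : [set` x0 :: s] = nth x0 (x0 :: s) @` `I_(size (x0 :: s))).
  apply/card_esym/inj_card_eq => i j; rewrite !inE => hi hj /eqP.
  by rewrite nth_uniq // => /eqP.
rewrite eqEsubset; split=> [x /= /(nthP x0)[i hi <-]|_ [i hi <-]]; first by exists i.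
exact: mem_nth.
Qed.

(** * Residues modulo powers of the uniformizer *)

Section Residues.
Variables (K : fieldType) (v : K -> int) (p : K) (q : nat).
Hypotheses (lf : local_field v) (up : uniformizer v p).
Hypothesis card_q : residue_field v #= `I_q.
Local Notation integral := (val_ge v 0).

Lemma coset_eq x y : ([set x + z | z in val_ge v 1] = [set y + z | z in val_ge v 1])
  <-> val_ge v 1 (x - y).
Proof.
have H a b : val_ge v 1 (a - b) ->
    [set a + z | z in val_ge v 1] `<=` [set b + z | z in val_ge v 1].
  move=> h _ [z hz <-]; exists (a - b + z); first exact: (val_geD lf).
  by rewrite addrA [b + _]addrC subrK.
split=> [e|h]; last by rewrite eqEsubset; split; apply: H; rewrite // -opprB (val_geN lf).
have : [set x + z | z in val_ge v 1] x by exists 0; rewrite ?addr0 //; exact: val_ge0.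
by rewrite e => -[z hz <-]; rewrite addrAC subrr add0r.
Qed.

Lemma digits_ex : exists D : seq K, [/\ size D = q, uniq D, forall d, d \in D -> integral d,
  forall x, integral x -> exists2 d, d \in D & val_ge v 1 (x - d)
  & forall d d', d \in D -> d' \in D -> val_ge v 1 (d - d') -> d = d'].
Proof.
have /card_set_bijP[f [ff fi fs]] := card_esym card_q.
have /choice[r hr] : forall k, exists x, (k < q)%N ->
    integral x /\ f k = [set x + z | z in val_ge v 1].
  move=> k; have [kq|] := ltnP k q; last by exists 0.
  by have [x hx ex] := ff k kq; exists x => _; split=> //; rewrite ex.
have rinj k l : (k < q)%N -> (l < q)%N -> val_ge v 1 (r k - r l) -> k = l.
  move=> kq lq /coset_eq; have [_ <-] := hr _ kq; have [_ <-] := hr _ lq.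
  by apply: fi; rewrite inE.
have memr d : d \in [seq r k | k <- iota 0 q] -> exists2 k, (k < q)%N & d = r k.
  by move=> /mapP[k]; rewrite mem_iota => /andP[_ kq] ->; exists k.
exists [seq r k | k <- iota 0 q]; split.
- by rewrite size_map size_iota.
- rewrite map_inj_in_uniq ?iota_uniq // => k l; rewrite !mem_iota => /andP[_ kq] /andP[_ lq] e.
  by apply: rinj; rewrite // e subrr; left.
- by move=> _ /memr[k kq ->]; have [] := hr _ kq.
- move=> x hx; have [k kq ek] : (f @` `I_q) [set x + z | z in val_ge v 1].
    by apply: fs; exists x.
  exists (r k); first by rewrite map_f // mem_iota.
  by apply/coset_eq; have [_ <-] := hr _ kq.
- by move=> _ _ /memr[k kq ->] /memr[l lq ->] /(rinj _ _ kq lq) ->.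
Qed.

(** 0 and 1 lie in different residue classes. *)
Lemma residue_gt1 : (1 < q)%N.
Proof.
have [D [sz un Dint Dsurj Dinj]] := digits_ex.
have [d0 d0D h0] := Dsurj 0 (val_ge0 v 0).
have [d1 d1D h1] := Dsurj 1 (val_ge1 lf).
have ne : d0 != d1.
  apply/eqP => e; move: h0; rewrite e => /(val_geB lf h1).
  rewrite opprB addrA subrK subr0 => /(val_geP v 1 (oner_neq0 _)).
  by rewrite (dval1 lf).
rewrite -sz; case: D {sz un Dint Dsurj Dinj} d0D d1D => [|a [|b D]] //.
by rewrite !inE => /eqP e0 /eqP e1; rewrite e0 e1 eqxx in ne.
Qed.

(** Digit expansion: representatives modulo p^(k+1) are [d + p * c], with [d] a representative of
    the residue field and [c] one modulo p^k. *)
Lemma reps_ex k : exists D : seq K, [/\ size D = (q ^ k)%N, uniq D,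
  forall d, d \in D -> integral d,
  forall x, integral x -> exists2 d, d \in D & val_ge v k (x - d)
  & forall d d', d \in D -> d' \in D -> val_ge v k (d - d') -> d = d'].
Proof.
have [p0 vp] := up; elim: k => [|k [C [szC unC Cint Csurj Cinj]]].
  exists [:: 0]; split=> //.
  - by move=> d; rewrite inE => /eqP ->; exact: val_ge0.
  - by move=> x hx; exists 0; rewrite ?inE ?subr0.
  - by move=> d d'; rewrite !inE => /eqP -> /eqP ->.
have [D [szD unD Dint Dsurj Dinj]] := digits_ex.
have pC c : integral c -> val_ge v 1 (p * c).
  by move=> hc; apply: (val_geM lf (m := 1) (n := 0)) => //; right; rewrite vp.
(* Reduction modulo [p] recovers the digit [d], and division by [p] then leaves a congruence for
   [c]. *)
have inj k' d d' c c' : d \in D -> d' \in D -> c \in C -> c' \in C -> 1 <= k' ->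
    val_ge v k' (d + p * c - (d' + p * c')) -> d = d' /\ val_ge v (k' - 1) (c - c').
  move=> hd hd' hc hc' k1 h; have e : d = d'.
    apply: Dinj => //.
    rewrite (_ : d - d' = d + p * c - (d' + p * c') + (p * c' - p * c)); last by ring.
    apply: (val_geD lf); first exact: val_ge_le h.
    by apply: (val_geB lf); apply/pC/Cint.
  split=> //; move: h; rewrite e (_ : _ - _ = p * (c - c')); last by ring.
  by rewrite (val_geMl lf) // vp.
exists [seq d + p * c | d <- D, c <- C]; split.
- by rewrite size_allpairs szD szC expnS.
- apply: allpairs_uniq => // -[d c] [d' c'] /allpairsP[[x y] /= [hx hy [-> ->]]].
  move=> /allpairsP[[x' y'] /= [hx' hy' [-> ->]]] /= e.
  have h : val_ge v 1 (x + p * y - (x' + p * y')) by left; apply/eqP; rewrite subr_eq0; apply/eqP.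
  have [ex _] := inj 1 _ _ _ _ hx hx' hy hy' (lexx 1) h.
  by move: e; rewrite ex => /addrI /(mulfI p0) ->.
- move=> _ /allpairsP[[d c] /= [hd hc ->]].
  by apply: (val_geD lf); [exact: Dint|apply: val_ge_le (pC _ (Cint _ hc))].
- move=> x hx; have [d hd h1] := Dsurj x hx.
  have hx' : integral ((x - d) / p).
    by rewrite mulrC (val_geMl lf) ?invr_neq0 // (dvalV lf) // vp.
  have [c hc h2] := Csurj _ hx'; exists (d + p * c); first by apply/allpairsP; exists (d, c).
  rewrite (_ : x - _ = p * ((x - d) / p - c)); last by field.
  by rewrite (val_geMl lf) // vp; apply: val_ge_le h2; lia.
- move=> _ _ /allpairsP[[d c] /= [hd hc ->]] /allpairsP[[d' c'] /= [hd' hc' ->]] h.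
  have [|ed hcc] := inj _ _ _ _ _ hd hd' hc hc' _ h; first by lia.
  by rewrite ed (Cinj c c') //; apply: val_ge_le hcc; lia.
Qed.

End Residues.

(** * Lattices in a totally ramified cubic extension *)

Section CubicExtension.
Variables (F : fieldType) (v : F -> int) (E : fieldExtType F) (w : E -> int).
Hypotheses (lfv : local_field v) (lfw : local_field w).
Hypothesis dimE : \dim {:E} = 3%N.
Hypothesis ramE : totally_ramified v w.
Implicit Types (x y : E) (c : F).

Lemma val_scale c x : c != 0 -> x != 0 -> w (c *: x) = 3 * v c + w x.
Proof.
move=> c0 x0; rewrite -mulr_algl (dvalM lfw) // ?scaler_eq0 ?negb_or ?c0 ?oner_neq0 //.
by rewrite ramE // dimE.
Qed.

Lemma val_ge_scaleP n c y : y != 0 ->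
  val_ge w n (c *: y) <-> c = 0 \/ n <= 3 * v c + w y.
Proof.
move=> y0; have [->|c0] := eqVneq c 0; first by rewrite scale0r; split; left.
rewrite (val_geP w) ?scaler_eq0 ?negb_or ?c0 // val_scale //.
by split=> [|[/eqP|//]]; [right|rewrite (negPf c0)].
Qed.

Lemma val_ge_scale n c y : val_ge v 0 c -> val_ge w n y -> val_ge w n (c *: y).
Proof.
move=> hc hy; have [->|y0] := eqVneq y 0; first by left; rewrite scaler0.
apply/(val_ge_scaleP _ _ y0); case: hc => [->|hc]; [by left|right].
by move/(val_geP w n y0): hy; lia.
Qed.

Lemma val_ge_alg c : val_ge w 0 c%:A <-> val_ge v 0 c.
Proof.
rewrite val_ge_scaleP ?oner_neq0 // (dval1 lfw).
by split=> [] [->|h]; [left|right; lia|left|right; lia].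
Qed.

(* Together with 1, such [y1] and [y2] represent all residues mod 3 of the
   valuation, hence form an [F]-basis of [E] whose coordinates are read off
   from valuations. *)
Definition transversal y1 y2 := [/\ y1 != 0, y2 != 0, ~~ (3 %| w y1)%Z,
  ~~ (3 %| w y2)%Z & ~~ (3 %| w y2 - w y1)%Z].

(** Scaling by [F] shifts [w] by multiples of 3, so the nonzero terms have valuations in distinct
    classes mod 3 and cannot cancel. *)
Lemma val_ge_coord y1 y2 n c0 c1 c2 : transversal y1 y2 ->
  val_ge w n (c0%:A + c1 *: y1 + c2 *: y2) ->
  [/\ val_ge w n c0%:A, val_ge w n (c1 *: y1) & val_ge w n (c2 *: y2)].
Proof.
move=> [y10 y20 d1 d2 d12] h.
have w1 := dval1 lfw.
have n1 : (1 : E) != 0 by exact: oner_neq0.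
have h01 : c0%:A != 0 :> E -> c1 *: y1 != 0 -> w c0%:A != w (c1 *: y1).
  rewrite !scaler_eq0 !negb_or => /andP[a0 _] /andP[a1 _]; rewrite !val_scale // w1.
  by apply: contraNneq d1 => /dvd3_sub; rewrite subr0.
have [|h1 h2] := val_ge_addl lfw _ h.
  rewrite [c2 *: _ == _]scaler_eq0 negb_or => s0 /andP[a2 _].
  rewrite [w (_ *: y2)]val_scale //.
  have [a0|a0] := eqVneq c0 0.
    move: s0; rewrite a0 scale0r add0r scaler_eq0 negb_or => /andP[a1 _].
    by rewrite val_scale //; apply: contraNneq d12 => /dvd3_sub.
  have [a1|a1] := eqVneq c1 0.
    rewrite a1 scale0r addr0 val_scale // w1.
    by apply: contraNneq d2 => /dvd3_sub; rewrite subr0.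
  have z0 : c0%:A != 0 :> E by rewrite scaler_eq0 negb_or a0.
  have z1 : c1 *: y1 != 0 :> E by rewrite scaler_eq0 negb_or a1.
  have [_ ->] := dvalD_min lfw z0 z1 (h01 z0 z1).
  rewrite !val_scale // w1 minEle; case: ifP => _.
    by apply: contraNneq d2 => /dvd3_sub; rewrite subr0.
  by apply: contraNneq d12 => /dvd3_sub.
by have [] := val_ge_addl lfw h01 h1.
Qed.

(** 0 lies in every [val_ge w n], hence so does each term, which forces its coefficient to
    vanish. *)
Lemma coord_eq0 y1 y2 c0 c1 c2 : transversal y1 y2 ->
  c0%:A + c1 *: y1 + c2 *: y2 = 0 -> [/\ c0 = 0, c1 = 0 & c2 = 0].
Proof.
move=> tr e.
have H y c : y != 0 -> (forall n, val_ge w n (c *: y)) -> c = 0.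
  by move=> y0 /(_ (3 * v c + w y + 1)) /(val_ge_scaleP _ _ y0) [//|h]; exfalso; lia.
have Hn n : [/\ val_ge w n c0%:A, val_ge w n (c1 *: y1) & val_ge w n (c2 *: y2)].
  by apply: val_ge_coord tr _; rewrite e; left.
have [y10 y20 _ _ _] := tr.
by split; [apply: (H 1); rewrite ?oner_neq0|apply: (H y1)|apply: (H y2)] => // n;
  have [] := Hn n.
Qed.

Lemma coord_inj y1 y2 a0 a1 a2 b0 b1 b2 : transversal y1 y2 ->
  a0%:A + a1 *: y1 + a2 *: y2 = b0%:A + b1 *: y1 + b2 *: y2 ->
  [/\ a0 = b0, a1 = b1 & a2 = b2].
Proof.
move=> tr e.
have [|/eqP h0 /eqP h1 /eqP h2] := @coord_eq0 y1 y2 (a0 - b0) (a1 - b1) (a2 - b2) tr.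
  by move/eqP: e; rewrite -subr_eq0 => /eqP <-; rewrite !scalerBl; ring.
by move: h0 h1 h2; rewrite !subr_eq0 => /eqP -> /eqP -> /eqP ->.
Qed.

Lemma coord_ex y1 y2 x : transversal y1 y2 ->
  exists c0 c1 c2, x = c0%:A + c1 *: y1 + c2 *: y2.
Proof.
move=> tr.
have sumE (k : 'I_3 -> F) : \sum_(i < 3) k i *: [tuple 1; y1; y2]`_i =
    (k 0)%:A + k 1 *: y1 + k (inord 2) *: y2.
  rewrite !big_ord_recl big_ord0 /= addr0 addrA; congr (_ + _ *: _ + _ *: _).
    by congr k; apply/val_inj.
  by congr k; apply/val_inj; rewrite /= inordK.
have fr : free [tuple 1; y1; y2].
  apply/freeP => k; rewrite sumE => /(coord_eq0 tr)[k0 k1 k2] i.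
  have [|i0] := eqVneq i 0; first by move=> ->.
  have [|i1] := eqVneq i 1; first by move=> ->.
  suff -> : i = inord 2 by [].
  by apply/val_inj; rewrite /= inordK //; case: i i0 i1 => [[|[|[|]]]].
have ba : basis_of {:E} [tuple 1; y1; y2] by rewrite basisEfree fr subvf dimE.
have := coord_basis ba (memvf x); rewrite sumE => ->.
by do 3 eexists.
Qed.

Local Notation integral := (val_ge v 0).
Local Notation omod := (submodule (base_ring v)).

Lemma omodD (N : set E) x y : omod N -> N x -> N y -> N (x + y).
Proof. by case=> _ h _; apply: h. Qed.

Lemma omodZ (N : set E) c x : omod N -> integral c -> N x -> N (c *: x).
Proof.
by case=> _ _ h hc hx; rewrite -mulr_algl; apply: h => //; exists c.
Qed.

Lemma omodB (N : set E) x y : omod N -> N x -> N y -> N (x - y).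
Proof.
move=> oN hx hy; apply: (omodD oN hx); rewrite -scaleN1r; apply: (omodZ oN) => //.
by apply/(val_geN lfv)/(val_ge1 lfv).
Qed.

Lemma omod_ring : omod (valuation_ring w).
Proof.
split=> [|x y|_ x [c hc <-] hx]; [exact: val_ge0|exact: (val_geD lfw)|].
by rewrite mulr_algl; apply: val_ge_scale.
Qed.

Definition lattice y1 y2 : set E := [set x | exists c0 c1 c2,
  [/\ integral c0, integral c1, integral c2 & x = c0%:A + c1 *: y1 + c2 *: y2]].

Lemma latticeP y1 y2 c0 c1 c2 : transversal y1 y2 ->
  lattice y1 y2 (c0%:A + c1 *: y1 + c2 *: y2) <->
  [/\ integral c0, integral c1 & integral c2].
Proof.
move=> tr; split=> [[b0 [b1 [b2 [h0 h1 h2 /(coord_inj tr)[-> -> ->]]]]]|[h0 h1 h2]] //.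
by exists c0, c1, c2.
Qed.

Lemma omod_lattice y1 y2 : omod (lattice y1 y2).
Proof.
split=> [|_ _ [a0 [a1 [a2 [h0 h1 h2 ->]]]] [b0 [b1 [b2 [k0 k1 k2 ->]]]]
  |_ _ [a ha <-] [a0 [a1 [a2 [h0 h1 h2 ->]]]]].
- by exists 0, 0, 0; rewrite !scale0r !addr0; split=> //; exact: val_ge0.
- exists (a0 + b0), (a1 + b1), (a2 + b2); split; try exact: (val_geD lfv).
  by rewrite !scalerDl; ring.
- exists (a * a0), (a * a1), (a * a2); split; try exact: (val_ge0M lfv).
  by rewrite mulr_algl !scalerDr !scalerA.
Qed.

Lemma lattice_least (N : set E) y1 y2 : omod N -> N 1 -> N y1 -> N y2 ->
  lattice y1 y2 `<=` N.
Proof.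
move=> oN n1 ny1 ny2 _ [c0 [c1 [c2 [h0 h1 h2 ->]]]].
by apply: (omodD oN); [apply: (omodD oN)|]; apply: (omodZ oN).
Qed.

Lemma lattice_gen y1 y2 : [/\ lattice y1 y2 1, lattice y1 y2 y1 & lattice y1 y2 y2].
Proof.
have i0 := val_ge0 v 0; have i1 := val_ge1 lfv.
split; [exists 1, 0, 0|exists 0, 1, 0|exists 0, 0, 1]; split=> //.
- by rewrite scale1r !scale0r !addr0.
- by rewrite scale1r !scale0r addr0 add0r.
- by rewrite scale1r !scale0r !add0r.
Qed.

(** The coordinate [c] on a basis vector [y] satisfies [n <= 3 * v c + w y]; with [w y - 2 <= n]
    this gives [-2 <= 3 * v c], hence [0 <= v c] since [v c] is an integer. *)
Lemma lattice_large y1 y2 n x : transversal y1 y2 -> -2 <= n ->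
  w y1 - 2 <= n -> w y2 - 2 <= n -> val_ge w n x -> lattice y1 y2 x.
Proof.
move=> tr n0 n1 n2; have [c0 [c1 [c2 ->]]] := coord_ex x tr.
move=> /(val_ge_coord tr)[]; have [y10 y20 _ _ _] := tr.
move=> /(val_ge_scaleP _ _ (oner_neq0 _)); rewrite (dval1 lfw) => h0.
move=> /(val_ge_scaleP _ _ y10) h1 /(val_ge_scaleP _ _ y20) h2.
by apply/(latticeP _ _ _ tr); split; [case: h0|case: h1|case: h2];
  try (by left); move=> h; right; lia.
Qed.

(** Both lattices contain every element of valuation at least [w y2], so the last generator matters
    only through its valuation. *)
Lemma lattice_eqr y1 y2 z : transversal y1 y2 -> z != 0 -> w z = w y2 ->
  w y1 <= w y2 -> 0 <= w y2 -> lattice y1 y2 = lattice y1 z.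
Proof.
move=> tr z0 wz le ge0; have trz : transversal y1 z.
  by case: tr => *; split; rewrite ?wz.
have [y10 y20 _ _ _] := tr.
have [g1 g2 g3] := lattice_gen y1 y2; have [k1 k2 k3] := lattice_gen y1 z.
rewrite eqEsubset; split; apply: lattice_least => //; try exact: omod_lattice.
- by apply: (lattice_large (n := w y2) trz); try lia; right.
- by apply: (lattice_large (n := w z) tr); try lia; right.
Qed.

Variables (p : F) (piE : E).
Hypotheses (up : uniformizer v p) (uE : uniformizer w piE).

Let p0 : p != 0. Proof. by case: up. Qed.
Let vp : v p = 1. Proof. by case: up. Qed.
Let pX0 k : p ^+ k != 0. Proof. by rewrite expf_neq0. Qed.
Let vpX k : v (p ^+ k) = k%:Z. Proof. by rewrite (dvalX lfv) // vp mulr1. Qed.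
Let ipX k : integral (p ^+ k). Proof. by right; rewrite vpX. Qed.
Let pi0 : piE != 0. Proof. by case: uE. Qed.
Let wpi : w piE = 1. Proof. by case: uE. Qed.

(** * Lattices in normal form and their inclusions *)

Definition rho (t : bool) : E := piE ^+ t.+1.
(* [p *: piE] rather than [piE]: both types [t] then satisfy
   [w (sig t) = 2 * w (rho t)], which makes the conditions on [i], [j] uniform. *)
Definition sig (t : bool) : E := if t then p *: piE else piE ^+ 2.

Lemma rho_neq0 t : rho t != 0. Proof. exact: expf_neq0. Qed.

Lemma val_rho t : w (rho t) = 1 + t%:Z.
Proof. by rewrite /rho (dvalX lfw) // wpi; case: t. Qed.

Lemma sig_neq0 t : sig t != 0.
Proof. by case: t => /=; rewrite ?scaler_eq0 ?negb_or ?p0 // expf_neq0. Qed.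

Lemma val_sig t : w (sig t) = 2 + 2 * t%:Z.
Proof.
by case: t => /=; [rewrite val_scale // vp wpi|rewrite (dvalX lfw) // wpi].
Qed.

Lemma val_beta t b : integral b -> rho t + b *: sig t != 0 /\
  w (rho t + b *: sig t) = 1 + t%:Z.
Proof.
move=> hb; have [->|b0] := eqVneq b 0.
  by rewrite scale0r addr0 rho_neq0 val_rho.
have bs0 : b *: sig t != 0 by rewrite scaler_eq0 negb_or b0 sig_neq0.
have wbs : w (b *: sig t) = 3 * v b + (2 + 2 * t%:Z).
  by rewrite val_scale ?sig_neq0 // val_sig.
move/(val_geP v 0 b0): hb => hb.
have [|-> ->] := dvalD_min lfw (rho_neq0 t) bs0; rewrite wbs val_rho; first by lia.
by split=> //; lia.
Qed.

Definition ngen t k b : E := p ^+ k *: (rho t + b *: sig t).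

Lemma ngen_neq0 t k b : integral b -> ngen t k b != 0.
Proof. by move=> /(val_beta t)[h _]; rewrite scaler_eq0 negb_or pX0. Qed.

Lemma val_ngen t k b : integral b -> w (ngen t k b) = 3 * k%:Z + 1 + t%:Z.
Proof. by move=> /(val_beta t)[h e]; rewrite val_scale // e vpX; lia. Qed.

Lemma psig_neq0 t k : p ^+ k *: sig t != 0.
Proof. by rewrite scaler_eq0 negb_or pX0 sig_neq0. Qed.

Lemma val_psig t k : w (p ^+ k *: sig t) = 3 * k%:Z + 2 + 2 * t%:Z.
Proof. by rewrite val_scale ?sig_neq0 // val_sig vpX; lia. Qed.

Definition nlattice t i j b := lattice (ngen t i b) (p ^+ j *: sig t).

Lemma trans_nlattice t i j b : integral b -> transversal (ngen t i b) (p ^+ j *: sig t).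
Proof.
move=> hb; split; rewrite ?ngen_neq0 ?psig_neq0 //;
  rewrite ?val_ngen // ?val_psig; case: t; lia.
Qed.

Lemma trans_rho t : transversal (rho t) (sig t).
Proof.
split; rewrite ?rho_neq0 ?sig_neq0 //; rewrite ?val_rho // ?val_sig; case: t; lia.
Qed.

Lemma val_ge_pdiv k c : integral (c / p ^+ k) <-> val_ge v k%:Z c.
Proof. by rewrite mulrC val_geMl ?invr_neq0 // (dvalV lfv) // vpX add0r opprK. Qed.

(** The basis [1], [rho t], [sig t] does not vary with [i], [j], [b], so lattices of one type can be
    compared in it. Removing the multiple [c1 / p ^+ i] of [ngen t i b] leaves [c2 - b * c1] on
    [sig t]. *)
Lemma nlattice_coord t i j b c0 c1 c2 : integral b ->
  nlattice t i j b (c0%:A + c1 *: rho t + c2 *: sig t) <->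
  [/\ integral c0, val_ge v i c1 & val_ge v j (c2 - b * c1)].
Proof.
move=> hb; have tr := trans_nlattice t i j hb.
rewrite (_ : _ + _ = c0%:A + (c1 / p ^+ i) *: ngen t i b +
  ((c2 - b * c1) / p ^+ j) *: (p ^+ j *: sig t)).
  split=> [/(latticeP _ _ _ tr)[h0 /val_ge_pdiv h1 /val_ge_pdiv h2]//|].
  by case=> h0 /val_ge_pdiv h1 /val_ge_pdiv h2; apply/latticeP.
rewrite /ngen !scalerA !divfK // scalerDr scalerA -!addrA; congr (_ + (_ + _)).
by rewrite -scalerDl; congr (_ *: _); ring.
Qed.

(** Up to a factor [p], the two types exchange [rho] and [sig]; this translates coordinates between
    types. *)
Lemma rhoTF : rho true = sig false. Proof. by []. Qed.
Lemma sigT : sig true = p *: rho false. Proof. by rewrite /rho expr1. Qed.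

Lemma val_unit c : val_ge v 1 c -> 1 - c != 0 /\ v (1 - c) = 0.
Proof.
move=> hc; have [->|c0] := eqVneq c 0; first by rewrite subr0 oner_neq0 (dval1 lfv).
move/(val_geP v 1 c0): hc => hc; have n1 : (1 : F) != 0 by exact: oner_neq0.
have Nc : - c != 0 by rewrite oppr_eq0.
have [|-> ->] := dvalD_min lfv n1 Nc; rewrite (dvalN lfv) (dval1 lfv) //; first by lia.
by split=> //; lia.
Qed.

(** The bound [j%:Z - i0%:Z] is an integer difference: when it is negative, every integral [b - b0]
    satisfies it. *)
Definition contained (t0 : bool) (i0 j0 : nat) b0 (t : bool) (i j : nat) b :=
  if t0 == t then [/\ (i <= i0)%N, (j <= j0)%N & val_ge v (j%:Z - i0%:Z) (b - b0)]
  else (j + t <= i0)%N.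

Lemma nlattice_contained t0 i0 j0 b0 t i j b : integral b0 -> integral b ->
  (i0 <= j0)%N -> (i <= j)%N ->
  nlattice t0 i0 j0 b0 `<=` nlattice t i j b <-> contained t0 i0 j0 b0 t i j b.
Proof.
move=> hb0 hb ij0 ij.
have -> : (nlattice t0 i0 j0 b0 `<=` nlattice t i j b) <->
    (nlattice t i j b (ngen t0 i0 b0) /\ nlattice t i j b (p ^+ j0 *: sig t0)).
  have [g1 g2 g3] := lattice_gen (ngen t0 i0 b0) (p ^+ j0 *: sig t0).
  have [k1 _ _] := lattice_gen (ngen t i b) (p ^+ j *: sig t).
  split=> [le|[h1 h2]]; first by split; apply: le.
  by apply: lattice_least => //; exact: omod_lattice.
have z0 := val_ge0 v 0; have zi k := val_ge0 v k.
have pn0 k c : val_ge v k c -> forall l, val_ge v (k + l%:Z) (p ^+ l * c).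
  by move=> hc l; rewrite addrC; apply: (val_geM lfv) => //; right; rewrite vpX.
have pge k l : val_ge v l (p ^+ k) <-> l <= k%:Z.
  by rewrite (val_geP v _ (pX0 k)) vpX.
rewrite /contained /ngen; case: eqP => [->|/eqP neq].
  rewrite (_ : p ^+ i0 *: _ = 0%:A + p ^+ i0 *: rho t + (p ^+ i0 * b0) *: sig t);
    last by rewrite scale0r add0r scalerDr scalerA.
  rewrite (_ : p ^+ j0 *: sig t = 0%:A + 0 *: rho t + p ^+ j0 *: sig t);
    last by rewrite !scale0r !add0r.
  rewrite !nlattice_coord // mulr0 subr0 !pge.
  rewrite (_ : p ^+ i0 * b0 - b * p ^+ i0 = p ^+ i0 * - (b - b0)); last by ring.
  rewrite (val_geMl lfv _ _ (pX0 i0)) (val_geN lfv) vpX !lez_nat.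
  by split=> [[[_ ? ?] [_ _ ?]]|[? ? ?]].
case: t t0 neq => -[] // _.
- rewrite -rhoTF.
  rewrite (_ : p ^+ j0 *: _ = 0%:A + p ^+ j0 *: rho true + 0 *: sig true);
    last by rewrite !scale0r add0r addr0.
  rewrite (_ : p ^+ i0 *: _ = 0%:A + (p ^+ i0 * b0) *: rho true +
     (p ^+ i0 / p) *: sig true); last first.
    by rewrite sigT scale0r add0r !scalerA divfK // scalerDr scalerA addrC.
  rewrite !nlattice_coord // pge.
  rewrite (_ : p ^+ i0 / p - b * (p ^+ i0 * b0) =
     p ^+ i0 * (p^-1 * (1 - p * (b * b0)))); last by field.
  have [|u0 u1] := @val_unit (p * (b * b0)).
    by apply: (val_geM lfv (m := 1) (n := 0)); [right; rewrite vp|exact: (val_ge0M lfv)].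
  have -> : val_ge v j (p ^+ i0 * (p^-1 * (1 - p * (b * b0)))) <-> j%:Z + 1 <= i0%:Z.
    rewrite (val_geMl lfv _ _ (pX0 i0)) (val_geMl lfv _ _ (invr_neq0 p0)).
    by rewrite (dvalV lfv) // vpX vp (val_geP v _ u0) u1; split=> h; lia.
  split=> [[[_ _ h] _]|h]; first by lia.
  split; split=> //; try lia.
    by apply: (val_ge_le _ (pn0 _ _ hb0 i0)); lia.
  rewrite sub0r; apply/(val_geN lfv); rewrite mulrC.
  by apply: (val_ge_le _ (pn0 _ _ hb j0)); lia.
- rewrite rhoTF sigT.
  rewrite (_ : p ^+ j0 *: _ = 0%:A + p ^+ j0.+1 *: rho false + 0 *: sig false);
    last by rewrite !scale0r add0r addr0 scalerA exprSr.
  rewrite (_ : p ^+ i0 *: _ = 0%:A + (p ^+ i0 * (p * b0)) *: rho false +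
     p ^+ i0 *: sig false); last first.
    by rewrite scale0r add0r scalerDr !scalerA addrC; congr (_ *: _ + _); ring.
  rewrite !nlattice_coord // pge.
  rewrite (_ : p ^+ i0 - b * (p ^+ i0 * (p * b0)) =
     p ^+ i0 * (1 - p * (b * b0))); last by ring.
  have [|u0 u1] := @val_unit (p * (b * b0)).
    by apply: (val_geM lfv (m := 1) (n := 0)); [right; rewrite vp|exact: (val_ge0M lfv)].
  have -> : val_ge v j (p ^+ i0 * (1 - p * (b * b0))) <-> j%:Z <= i0%:Z.
    by rewrite (val_geMl lfv _ _ (pX0 i0)) vpX (val_geP v _ u0) u1; split=> h; lia.
  split=> [[[_ _ h] _]|h]; first by lia.
  have hpb : integral (p * b0) by apply: (val_ge0M lfv) => //; right; rewrite vp.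
  split; split=> //; try lia.
    by apply: (val_ge_le _ (pn0 _ _ hpb i0)); lia.
  rewrite sub0r; apply/(val_geN lfv); rewrite mulrC.
  by apply: (val_ge_le _ (pn0 _ _ hb j0.+1)); lia.
Qed.

(** [i + j + t] is the colength of the lattice in the valuation ring, see [colength_nlattice]. *)
Lemma contained_size t0 i0 j0 b0 t i j b : (i0 <= j0)%N -> (i <= j)%N ->
  contained t0 i0 j0 b0 t i j b -> (i + j + t <= i0 + j0 + t0)%N.
Proof.
rewrite /contained => ? ?; case: eqP => [<- [? ? _]|_]; first by lia.
by case: t0 t => [] [] /=; lia.
Qed.

(** Distinct types are impossible: [j + t <= i0] bounds [i + j + t] by [2 * i0 - t], whereas
    [i0 + j0 + t0] is at least [2 * i0 + t0] and one of [t], [t0] is 1. *)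
Lemma contained_anti t0 i0 j0 b0 t i j b : (i0 <= j0)%N -> (i <= j)%N ->
  contained t0 i0 j0 b0 t i j b -> (i0 + j0 + t0 <= i + j + t)%N ->
  [/\ t = t0, i = i0, j = j0 & val_ge v (j%:Z - i%:Z) (b - b0)].
Proof.
rewrite /contained => ? ?; case: eqP => [<- [? ? h] ?|nt]; last first.
  by move=> l1 l2; exfalso; case: t0 t nt l1 l2 => [] [] //= _; lia.
have ei : i = i0 by lia.
by subst i; split=> //; lia.
Qed.

Lemma nlattice_size t0 i0 j0 b0 t i j b : integral b0 -> integral b ->
  (i0 <= j0)%N -> (i <= j)%N -> nlattice t0 i0 j0 b0 `<=` nlattice t i j b ->
  (i + j + t <= i0 + j0 + t0)%N.
Proof. by move=> ? ? ? ? /nlattice_contained h; apply/contained_size/h. Qed.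

Lemma nlattice_eqP t0 i0 j0 b0 t i j b : integral b0 -> integral b ->
  (i0 <= j0)%N -> (i <= j)%N -> nlattice t0 i0 j0 b0 = nlattice t i j b <->
  [/\ t = t0, i = i0, j = j0 & val_ge v (j%:Z - i%:Z) (b - b0)].
Proof.
move=> hb0 hb ij0 ij; split=> [e|[? ? ? h]].
  have /(nlattice_contained _ _ hb0 hb ij0 ij) c :
    nlattice t0 i0 j0 b0 `<=` nlattice t i j b by rewrite e.
  apply: (contained_anti ij0 ij c).
  by apply: (nlattice_size hb hb0 ij ij0); rewrite e.
subst t i j; rewrite eqEsubset.
split; [apply/(nlattice_contained t0 t0 hb0 hb ij0 ij)
       |apply/(nlattice_contained t0 t0 hb hb0 ij ij0)];
  rewrite /contained eqxx; split=> //.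
by rewrite -[b0 - b]opprB; apply/(val_geN lfv).
Qed.

Lemma nlattice_size_lt t0 i0 j0 b0 t i j b : integral b0 -> integral b ->
  (i0 <= j0)%N -> (i <= j)%N -> nlattice t0 i0 j0 b0 `<` nlattice t i j b ->
  (i + j + t < i0 + j0 + t0)%N.
Proof.
move=> hb0 hb ij0 ij; rewrite properEneq => -[/eqP ne le]; rewrite ltnNge; apply/negP => ge.
case: ne; apply/(nlattice_eqP t0 t hb0 hb ij0 ij); apply: contained_anti => //.
exact/nlattice_contained.
Qed.

(** * Existence of the normal form *)

Lemma val_comb_ndiv y1 y2 c1 c2 : transversal y1 y2 ->
  c1 *: y1 + c2 *: y2 != 0 -> ~~ (3 %| w (c1 *: y1 + c2 *: y2))%Z.
Proof.
move=> [y10 y20 d1 d2 d12].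
have [->|c10] := eqVneq c1 0.
  rewrite scale0r add0r scaler_eq0 negb_or => /andP[c20 _].
  by rewrite val_scale // dvd3D.
have [->|c20] := eqVneq c2 0; first by rewrite scale0r addr0 val_scale // dvd3D.
move=> _; have z1 : c1 *: y1 != 0 by rewrite scaler_eq0 negb_or c10.
have z2 : c2 *: y2 != 0 by rewrite scaler_eq0 negb_or c20.
have [|_ ->] := dvalD_min lfw z1 z2; rewrite !val_scale //.
  by apply: contraNneq d12 => /dvd3_sub.
by rewrite minEle; case: ifP => _; rewrite dvd3D.
Qed.

Lemma lattice_normal_form (N : set E) : omod N -> N 1 ->
  N `<=` valuation_ring w -> (forall x, exists k : nat, N (p ^+ k *: x)) ->
  exists t i j b, [/\ integral b, (i <= j)%N & N = nlattice t i j b].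
Proof.
move=> oN N1 NO full.
have scaleN a c x : a != 0 -> v a <= v c -> N (a *: x) -> N (c *: x).
  move=> a0 ac hx; have [->|c0] := eqVneq c 0; first by rewrite scale0r; case: oN.
  have -> : c *: x = (c / a) *: (a *: x) by rewrite scalerA divfK.
  apply: (omodZ oN) => //; right.
  by rewrite (dvalM lfv) ?invr_neq0 // (dvalV lfv) //; lia.
(* [n] is the least valuation prime to 3 in [N], attained at [al]; its remainder mod 3 gives the
   type [t] and its quotient gives [i]. *)
have [||n [al [Nal al0 nd wal]] min] :=
    @int_min (fun n => exists x, [/\ N x, x != 0, ~~ (3 %| w x)%Z & w x = n]) 0.
- have [k hk] := full piE; exists (3 * k%:Z + 1); exists (p ^+ k *: piE).
  have wk : w (p ^+ k *: piE) = 3 * k%:Z + 1 by rewrite val_scale // vpX wpi.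
  by split=> //; rewrite ?scaler_eq0 ?negb_or ?pX0 // wk dvd3D.
- by move=> n [x [/NO h x0 _ <-]]; apply/(val_geP w 0 x0).
have minN x : N x -> x != 0 -> ~~ (3 %| w x)%Z -> n <= w x.
  by move=> hx x0 dx; apply: min; exists x.
have n0 : 0 <= n by rewrite -wal; apply/(val_geP w 0 al0)/NO.
rewrite wal in nd.
have [t [i en]] : exists (t : bool) (i : nat), n = 3 * i%:Z + 1 + t%:Z.
  exists ((n %% 3)%Z == 2), `|(n %/ 3)%Z|%N.
  by case: eqP; lia.
have t1 : (t <= 1)%N by case: (t).
have [a0 [a1 [a2 eal]]] := coord_ex al (trans_rho t).
have : val_ge w n (a0%:A + a1 *: rho t + a2 *: sig t) by rewrite -eal; right; rewrite wal.
move=> /(val_ge_coord (trans_rho t))[h0 h1 h2].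
move: (h0) => /(val_ge_scaleP _ _ (oner_neq0 _)); rewrite (dval1 lfw) => g0.
move: (h1) => /(val_ge_scaleP _ _ (rho_neq0 t)); rewrite val_rho => g1.
move: (h2) => /(val_ge_scaleP _ _ (sig_neq0 t)); rewrite val_sig => g2.
have i0 : integral a0 by case: g0 => [->|?]; [left|right; lia].
(* Only the [rho] term can have valuation exactly [n], the other two being in other classes mod 3;
   otherwise [al] would have valuation above [n]. *)
have [a10 va1] : a1 != 0 /\ v a1 = i%:Z.
  apply: contrapT => bad.
  suff : val_ge w (n + 1) al by move/(val_geP w _ al0); rewrite wal; lia.
  rewrite eal; apply: (val_geD lfw); [apply: (val_geD lfw)|].
  - apply/(val_ge_scaleP _ _ (oner_neq0 _)); rewrite (dval1 lfw).
    by case: g0 => [|?]; [left|right; lia].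
  - apply/(val_ge_scaleP _ _ (rho_neq0 t)); rewrite val_rho.
    case: g1 => [|?]; first by left.
    have [->|a10] := eqVneq a1 0; [by left|right].
    by have : v a1 <> i%:Z by [move=> ?; apply: bad]; lia.
  - apply/(val_ge_scaleP _ _ (sig_neq0 t)); rewrite val_sig.
    by case: g2 => [|?]; [left|right; lia].
set b := a2 / a1.
have hb : integral b.
  rewrite /b; case: g2 => [->|?]; first by left; rewrite mul0r.
  have [->|a20] := eqVneq a2 0; first by left; rewrite mul0r.
  right; rewrite (dvalM lfv) ?invr_neq0 // (dvalV lfv) // va1.
  by lia.
have Ng : N (ngen t i b).
  apply: (scaleN a1); rewrite ?va1 ?vpX //.
  rewrite scalerDr scalerA mulrC divfK //.
  rewrite (_ : _ + _ = al - a0%:A); last by rewrite eal; ring.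
  by apply: (omodB oN) => //; exact: (omodZ oN i0 N1).
(* The least [v c] with [c *: sig t] in [N] will be [j]. Integrality gives
   [0 <= 3 * v c + 2 + 2 * t], whence the lower bound -1. *)
have [||z [c [c0 Nc vc]] minc] :=
    @int_min (fun n => exists c, [/\ c != 0, N (c *: sig t) & v c = n]) (-1).
- by have [k hk] := full (sig t); exists k%:Z, (p ^+ k); split.
- move=> m [c [c0 /NO /(val_ge_scaleP _ _ (sig_neq0 t)) [/eqP|]]].
    by rewrite (negPf c0).
  by rewrite val_sig => h <-; lia.
have wc : w (c *: sig t) = 3 * z + 2 + 2 * t%:Z.
  by rewrite val_scale ?sig_neq0 // val_sig vc; lia.
have iz : i%:Z <= z.
  have := minN _ Nc; rewrite scaler_eq0 negb_or c0 sig_neq0 wc.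
  by move=> /(_ isT) h; have := h _; lia.
have [j ez] : exists j : nat, z = j%:Z by exists `|z|%N; lia.
rewrite ez in vc minc; have Ns : N (p ^+ j *: sig t) by apply: (scaleN c) => //; rewrite vc vpX.
rewrite ez in iz; exists t, i, j, b; split=> //.
have tr := trans_nlattice t i j hb.
rewrite eqEsubset; split; last exact: lattice_least.
move=> x Nx; have [c0' [c1 [c2 ex]]] := coord_ex x tr.
have := NO _ Nx; rewrite /valuation_ring ex => /(val_ge_coord tr)[/val_ge_alg k0 _ _].
(* Without its component on 1, [x] is 0 or has valuation prime to 3, hence at least [n]. This makes
   [c1] integral, and minimality of [j] then makes [c2] integral. *)
have Ny : N (c1 *: ngen t i b + c2 *: (p ^+ j *: sig t)).
  rewrite (_ : _ + _ = x - c0'%:A); last by rewrite ex; ring.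
  by apply: (omodB oN) => //; exact: (omodZ oN k0 N1).
have hy : val_ge w n (0%:A + c1 *: ngen t i b + c2 *: (p ^+ j *: sig t)).
  rewrite scale0r add0r.
  have [y0|y0] := eqVneq (c1 *: ngen t i b + c2 *: (p ^+ j *: sig t)) 0; first by left.
  by right; apply: minN => //; exact: val_comb_ndiv.
have [_ /(val_ge_scaleP _ _ (ngen_neq0 t i hb)) k1 _] := val_ge_coord tr hy.
have {}k1 : integral c1.
  by case: k1 => [->|]; [left|rewrite val_ngen // => ?; right; lia].
apply/(latticeP _ _ _ tr); split=> //.
have : N ((c2 * p ^+ j) *: sig t).
  rewrite -scalerA (_ : _ *: _ = c1 *: ngen t i b + c2 *: (p ^+ j *: sig t) - c1 *: ngen t i b);
    last by ring.
  by apply: (omodB oN) => //; apply: (omodZ oN).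
have [->|c20] := eqVneq c2 0 => hc; first exact: val_ge0.
have := minc (v (c2 * p ^+ j)); rewrite (dvalM lfv) // vpX => h; right.
suff : j%:Z <= v c2 + j%:Z by lia.
by apply: h; exists (c2 * p ^+ j); rewrite mulf_neq0 // (dvalM lfv) // vpX.
Qed.

(** * Orders, their duals and multiplier rings *)

(** For such a [g], the elements [1], [g], [g ^+ 2] represent the three classes of valuations mod 3
    and form a basis of [E]. *)
Definition generator g := [/\ g != 0, ~~ (3 %| w g)%Z & 0 <= w g].

Section Generator.
Variable g : E.
Hypothesis gen : generator g.

Let g0 : g != 0. Proof. by case: gen. Qed.
Let gnd : ~~ (3 %| w g)%Z. Proof. by case: gen. Qed.
Let gpos : 0 <= w g. Proof. by case: gen. Qed.

Lemma val_sq : w (g ^+ 2) = 2 * w g.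
Proof. by rewrite (dvalX lfw). Qed.

Lemma trans_sq k l : transversal (p ^+ k *: g) (p ^+ l *: g ^+ 2).
Proof.
have nz m x : x != 0 -> p ^+ m *: x != 0 by move=> x0; rewrite scaler_eq0 negb_or pX0.
have g20 : g ^+ 2 != 0 by rewrite expf_neq0.
split; rewrite ?nz // !val_scale // ?val_sq ?vpX ?dvd3D //; first by lia.
by rewrite (_ : _ - _ = 3 * (l%:Z - k%:Z) + w g) ?dvd3D //; lia.
Qed.

Lemma trans_pow : transversal g (g ^+ 2).
Proof. by have := trans_sq 0 0; rewrite expr0 !scale1r. Qed.

(** In each term of [g ^+ 3] the valuation is at least [3 * w g], which leaves a nonnegative
    valuation for the coefficient of a power of [g] of degree at most 2. *)
Lemma cubic_relation : exists a0 a1 a2, [/\ integral a0, integral a1, integral a2 &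
  g ^+ 3 = a0%:A + a1 *: g + a2 *: g ^+ 2].
Proof.
have [a0 [a1 [a2 e]]] := coord_ex (g ^+ 3) trans_pow.
have g30 : g ^+ 3 != 0 by rewrite expf_neq0.
have : val_ge w (3 * w g) (g ^+ 3) by right; rewrite (dvalX lfw).
rewrite e => /(val_ge_coord trans_pow)[].
move=> /(val_ge_scaleP _ _ (oner_neq0 _)) + /(val_ge_scaleP _ _ g0) +
  /(val_ge_scaleP _ _ (expf_neq0 2 g0)).
rewrite (dval1 lfw) val_sq => h0 h1 h2; exists a0, a1, a2.
by split=> //; [case: h0|case: h1|case: h2];
  try (by left); move=> ?; right; lia.
Qed.

(** The order o[g]; [cubic_relation] closes it under products. *)
Definition powers : set E := lattice g (g ^+ 2).

Lemma powers_mulg x : powers x -> powers (g * x).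
Proof.
have [a0 [a1 [a2 [h0 h1 h2 e]]]] := cubic_relation.
move=> [c0 [c1 [c2 [k0 k1 k2 ->]]]].
exists (c2 * a0), (c0 + c2 * a1), (c1 + c2 * a2).
split; try (by apply: (val_ge0M lfv));
  try (by apply: (val_geD lfv) => //; apply: (val_ge0M lfv)).
transitivity (c0 *: g + c1 *: g ^+ 2 + c2 *: (g ^+ 3)); first by alg_ring.
by rewrite e; alg_ring.
Qed.

Lemma powersM x y : powers x -> powers y -> powers (x * y).
Proof.
have oP := omod_lattice g (g ^+ 2).
move=> [c0 [c1 [c2 [k0 k1 k2 ->]]]] hy.
rewrite !mulrDl -!scalerAl mul1r.
have hgy := powers_mulg hy.
apply: (omodD oP); [apply: (omodD oP)|]; apply: (omodZ oP) => //.
by rewrite expr2 -mulrA; apply: powers_mulg.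
Qed.

(** The order o + p^n o[g], see [gen_orderP]. *)
Definition gen_order n : set E := lattice (p ^+ n *: g) (p ^+ n *: g ^+ 2).
Definition gen_dual n : set E := lattice g (p ^+ n *: g ^+ 2).

Lemma trans_gen_dual n : transversal g (p ^+ n *: g ^+ 2).
Proof. by have := trans_sq 0 n; rewrite expr0 scale1r. Qed.

Lemma gen_orderP n x : gen_order n x <->
  exists a y, [/\ integral a, powers y & x = a%:A + p ^+ n *: y].
Proof.
split=> [[a [b [c [ha hb hc ->]]]]|[a [y [ha [a0 [a1 [a2 [h0 h1 h2 ->]]]] ->]]]].
  exists a, (0%:A + b *: g + c *: g ^+ 2); split=> //.
    by exists 0, b, c; split=> //; exact: val_ge0.
  by alg_ring.
exists (a + p ^+ n * a0), a1, a2; split=> //.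
  by apply: (val_geD lfv) => //; apply: (val_ge0M lfv).
by alg_ring.
Qed.

Lemma powers_gen_dual n x : gen_dual n x -> powers x.
Proof.
have [g1 g2 g3] := lattice_gen g (g ^+ 2).
have oP := omod_lattice g (g ^+ 2).
apply: lattice_least => //; exact: (omodZ oP).
Qed.

Lemma scale_powers_gen_dual n x : powers x -> gen_dual n (p ^+ n *: x).
Proof.
move=> [a0 [a1 [a2 [h0 h1 h2 ->]]]].
exists (p ^+ n * a0), (p ^+ n * a1), a2; split=> //; try exact: (val_ge0M lfv).
by alg_ring.
Qed.

Lemma gen_orderM n x y : gen_order n x -> gen_order n y -> gen_order n (x * y).
Proof.
have oP := omod_lattice g (g ^+ 2).
move=> /gen_orderP[a [x' [ha hx ->]]] /gen_orderP[b [y' [hb hy ->]]].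
apply/gen_orderP; exists (a * b), (a *: y' + b *: x' + p ^+ n *: (x' * y')).
split; first exact: (val_ge0M lfv).
  apply: (omodD oP); last by apply: (omodZ oP) => //; apply: powersM.
  by apply: (omodD oP); apply: (omodZ oP).
by alg_ring.
Qed.

Lemma gen_order_mul_gen_dual n x y : gen_order n x -> gen_dual n y -> gen_dual n (x * y).
Proof.
have oD := omod_lattice g (p ^+ n *: g ^+ 2).
move=> /gen_orderP[a [x' [ha hx ->]]] hy; rewrite mulrDl -!scalerAl mul1r.
apply: (omodD oD); first exact: (omodZ oD).
by apply: scale_powers_gen_dual; apply: powersM => //; exact: powers_gen_dual hy.
Qed.

Definition multipliers (M : set E) : set E := [set x | forall y, M y -> M (x * y)].

Lemma multipliers_gen_order n : multipliers (gen_order n) = gen_order n.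
Proof.
rewrite eqEsubset; split=> x; last by move=> hx y; apply: gen_orderM.
have [h1 _ _] := lattice_gen (p ^+ n *: g) (p ^+ n *: g ^+ 2).
by move=> /(_ _ h1); rewrite mulr1.
Qed.

(** A multiplier [x] sends 1 into the dual. After subtraction of an element of the order, only a
    term [c1 *: g] is left; it sends [g] to [c1 *: g ^+ 2], so [p ^+ n] divides [c1]. *)
Lemma multipliers_gen_dual n : multipliers (gen_dual n) = gen_order n.
Proof.
have oD := omod_lattice g (p ^+ n *: g ^+ 2).
have oR := omod_lattice (p ^+ n *: g) (p ^+ n *: g ^+ 2).
rewrite eqEsubset; split=> x; last by move=> hx y; apply: gen_order_mul_gen_dual.
have [h1 h2 _] := lattice_gen g (p ^+ n *: g ^+ 2).
have [k1 k2 k3] := lattice_gen (p ^+ n *: g) (p ^+ n *: g ^+ 2).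
move=> hx; have := hx _ h1; rewrite mulr1 => -[c0 [c1 [c2 [i0 i1 i2 e]]]].
have Rz : gen_order n (c0%:A + c2 *: (p ^+ n *: g ^+ 2)).
  by apply: (omodD oR); apply: (omodZ oR).
have := omodB oD (hx _ h2) (gen_order_mul_gen_dual Rz h2).
rewrite (_ : _ - _ = c1 *: g ^+ 2); last by rewrite e; alg_ring.
rewrite (_ : c1 *: _ = 0%:A + 0 *: g + (c1 / p ^+ n) *: (p ^+ n *: g ^+ 2)); last first.
  by rewrite !scale0r !add0r scalerA divfK.
move=> /(latticeP _ _ _ (trans_gen_dual n))[_ _ j1].
rewrite e (_ : c0%:A + _ + _ = c0%:A + c2 *: (p ^+ n *: g ^+ 2) +
  (c1 / p ^+ n) *: (p ^+ n *: g)); first by apply: (omodD oR) => //; apply: (omodZ oR).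
by rewrite !scale_in_alg; field; rewrite fmorph_eq0.
Qed.

(* Modulo [p], both 1 and [g] are needed to generate [gen_dual n], whereas a
   principal module has a single generator. *)
Lemma gen_dual_not_principal n u : u != 0 -> (0 < n)%N ->
  (forall x, gen_dual n x <-> gen_order n (u * x)) -> False.
Proof.
move=> c0 n0 H.
have [h1 h2 _] := lattice_gen g (p ^+ n *: g ^+ 2).
have [k1 _ _] := lattice_gen (p ^+ n *: g) (p ^+ n *: g ^+ 2).
(* Let [d0], [d1], [d2] be the coordinates of [u^-1]. Writing 1 and [g] as [u^-1] times elements of
   o + p^n o[g] gives, modulo [p], [a * d0 = 1], [a * d1 = 0] and [b * d1 = 1], which is
   contradictory. *)
have hd : gen_dual n u^-1 by apply/H; rewrite mulfV.
have /H := h1; rewrite mulr1 => /gen_orderP[a [y [ha hy ey]]].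
have /H := h2 => /gen_orderP[b [z [hb hz ez]]].
have pd := powers_gen_dual hd.
have [r0 [r1 [r2 [ir0 ir1 ir2 edy]]]] := powersM pd hy.
have [s0 [s1 [s2 [is0 is1 is2 edz]]]] := powersM pd hz.
have [d0 [d1 [d2 [id0 id1 id2 ed]]]] := pd.
have e1 : (a * d0 + p ^+ n * r0)%:A + (a * d1 + p ^+ n * r1) *: g +
    (a * d2 + p ^+ n * r2) *: g ^+ 2 = 1%:A + 0 *: g + 0 *: g ^+ 2.
  transitivity (a *: u^-1 + p ^+ n *: (u^-1 * y)); first by rewrite edy ed; alg_ring.
  transitivity (u^-1 * (a%:A + p ^+ n *: y)); first by alg_ring.
  by rewrite -ey mulVf // scale1r !scale0r !addr0.
have e2 : (b * d0 + p ^+ n * s0)%:A + (b * d1 + p ^+ n * s1) *: g +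
    (b * d2 + p ^+ n * s2) *: g ^+ 2 = 0%:A + 1 *: g + 0 *: g ^+ 2.
  transitivity (b *: u^-1 + p ^+ n *: (u^-1 * z)); first by rewrite edz ed; alg_ring.
  transitivity (u^-1 * (b%:A + p ^+ n *: z)); first by alg_ring.
  by rewrite -ez mulKf // scale1r !scale0r addr0 add0r.
have [q00 q01 _] := coord_inj trans_pow e1.
have [_ q11 _] := coord_inj trans_pow e2.
have ge1 r : integral r -> val_ge v 1 (p ^+ n * r).
  by move=> hr; rewrite (val_geMl lfv) // vpX; apply: val_ge_le hr; lia.
have unit r s t : r * s + p ^+ n * t = 1 -> integral r -> integral s -> integral t ->
    [/\ r != 0, s != 0, v r = 0 & v s = 0].
  move=> e ir is_ it; have [] := val_unit (ge1 _ it).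
  rewrite -{1 2}e addrK mulf_eq0 negb_or => /andP[rn0 sn0].
  rewrite (dvalM lfv) // => vrs.
  by move/(val_geP v 0 rn0): ir; move/(val_geP v 0 sn0): is_; split=> //; lia.
have [an0 _ va _] := unit _ _ _ q00 ha id0 ir0.
have [_ d1n0 _ vd1] := unit _ _ _ q11 hb id1 is1.
have : val_ge v 1 (a * d1).
  rewrite (_ : a * d1 = - (p ^+ n * r1)) ?(val_geN lfv); first exact: ge1.
  by apply/eqP; rewrite -addr_eq0 q01.
by move=> /(val_geP v 1 (mulf_neq0 an0 d1n0)); rewrite (dvalM lfv) // va vd1.
Qed.
End Generator.

(* Any nonzero functional would serve for the duality below; this one has an
   explicit dual basis. *)
Definition top_coef g x : F := xget 0 [set c2 | exists c0 c1,
  x = c0%:A + c1 *: g + c2 *: g ^+ 2].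

Section Tau.
Variable g : E.
Hypothesis gen : generator g.

Let tr : transversal g (g ^+ 2). Proof. exact: (trans_pow gen). Qed.

Lemma top_coefE c0 c1 c2 : top_coef g (c0%:A + c1 *: g + c2 *: g ^+ 2) = c2.
Proof.
rewrite /top_coef; case: xgetP => [y _ [b0 [b1 /(coord_inj tr)[_ _ ->]]] //|].
by move=> /(_ c2) h; case: h; exists c0, c1.
Qed.

Lemma top_coef_lin c x y : top_coef g (c *: x + y) = c * top_coef g x + top_coef g y.
Proof.
have [a0 [a1 [a2 ->]]] := coord_ex x tr; have [b0 [b1 [b2 ->]]] := coord_ex y tr.
rewrite !top_coefE -(top_coefE (c * a0 + b0) (c * a1 + b1) (c * a2 + b2)); congr top_coef.
by alg_ring.
Qed.

Lemma top_coefZ c x : top_coef g (c *: x) = c * top_coef g x.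
Proof.
have t0 : top_coef g 0 = 0 by rewrite -(top_coefE 0 0 0) !scale0r !addr0.
by rewrite -[c *: x]addr0 top_coef_lin t0 addr0.
Qed.

Lemma top_coefD x y : top_coef g (x + y) = top_coef g x + top_coef g y.
Proof. by rewrite -[x in LHS]scale1r top_coef_lin mul1r. Qed.

Lemma top_coef_nondeg t0 t1 t2 :
  exists u, [/\ top_coef g u = t0, top_coef g (u * g) = t1 & top_coef g (u * g ^+ 2) = t2].
Proof.
have [a0 [a1 [a2 e]]] := coord_ex (g ^+ 3) tr.
(* For [u = c0%:A + c1 *: g + t0 *: g ^+ 2] the three values are [t0], [c1 + t0 * a2] and
   [c0 + c1 * a2 + t0 * (a2 ^+ 2 + a1)]: the system is triangular. *)
set c1 := t1 - t0 * a2; set c0 := t2 - c1 * a2 - t0 * (a2 ^+ 2 + a1).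
exists (c0%:A + c1 *: g + t0 *: g ^+ 2); split; first by rewrite top_coefE.
- rewrite (_ : _ * g = (t0 * a0)%:A + (c0 + t0 * a1) *: g + t1 *: g ^+ 2) ?top_coefE //.
  transitivity (c0 *: g + c1 *: g ^+ 2 + t0 *: g ^+ 3); first by alg_ring.
  by rewrite e /c1; alg_ring.
- rewrite (_ : _ * g ^+ 2 = (c1 * a0 + t0 * a2 * a0)%:A +
    (c1 * a1 + t0 * (a0 + a2 * a1)) *: g + t2 *: g ^+ 2) ?top_coefE //.
  transitivity (c0 *: g ^+ 2 + c1 *: g ^+ 3 + t0 *: (g * g ^+ 3)); first by alg_ring.
  transitivity (c0 *: g ^+ 2 + (c1 + t0 * a2) *: g ^+ 3 + (t0 * a0) *: g +
    (t0 * a1) *: g ^+ 2); first by rewrite [in g * _]e; alg_ring.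
  by rewrite e /c0; alg_ring.
Qed.

(** The dual of the order is p^(-n) times [gen_dual g n]. The latter is a module over the order on
    which [top_coef] is divisible by [p ^+ n]; conversely, testing [x] against the three generators
    of the order gives a triangular system. *)
Lemma top_coef_dual n x : (forall y, gen_order g n y -> integral (top_coef g (x * y))) <->
  gen_dual g n (p ^+ n *: x).
Proof.
have trD := trans_gen_dual gen n.
have tDn z : gen_dual g n z -> integral (top_coef g z / p ^+ n).
  move=> [c0 [c1 [c2 [_ _ h ->]]]].
  by rewrite scalerA top_coefE mulfK.
split=> [h|h y hy]; last first.
  have : gen_dual g n (y * (p ^+ n *: x)) by apply: (gen_order_mul_gen_dual gen).
  move=> /tDn; rewrite (_ : y * _ = p ^+ n *: (x * y)); last by alg_ring.
  by rewrite top_coefZ mulrAC divff // mul1r.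
have [a0 [a1 [a2 [h0 h1 h2 e]]]] := cubic_relation gen.
have [k1 k2 k3] := lattice_gen (p ^+ n *: g) (p ^+ n *: g ^+ 2).
have := h _ k3; have := h _ k2; have := h _ k1; rewrite -/(gen_order g n).
have [x0 [x1 [x2 ->]]] := coord_ex x tr.
rewrite mulr1 top_coefE => q0.
rewrite (_ : _ * (p ^+ n *: g) = (p ^+ n * (x2 * a0))%:A +
    (p ^+ n * (x0 + x2 * a1)) *: g + (p ^+ n * (x1 + x2 * a2)) *: g ^+ 2); last first.
  transitivity (p ^+ n *: (x0 *: g + x1 *: g ^+ 2 + x2 *: g ^+ 3)); first by alg_ring.
  by rewrite e; alg_ring.
rewrite top_coefE => q1.
rewrite (_ : _ * (p ^+ n *: g ^+ 2) = (p ^+ n * (x1 * a0 + x2 * a2 * a0))%:A +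
    (p ^+ n * (x1 * a1 + x2 * (a0 + a2 * a1))) *: g +
    (p ^+ n * (x0 + x1 * a2 + x2 * (a2 ^+ 2 + a1))) *: g ^+ 2); last first.
  transitivity (p ^+ n *: (x0 *: g ^+ 2 + x1 *: g ^+ 3 + x2 *: (g * g ^+ 3)));
    first by alg_ring.
  transitivity (p ^+ n *: (x0 *: g ^+ 2 + (x1 + x2 * a2) *: g ^+ 3 +
    (x2 * a0) *: g + (x2 * a1) *: g ^+ 2)); first by rewrite [in g * _]e; alg_ring.
  by rewrite e; alg_ring.
rewrite top_coefE => q2.
have j1 : integral (p ^+ n * x1).
  rewrite (_ : p ^+ n * x1 = p ^+ n * (x1 + x2 * a2) - p ^+ n * (x2 * a2));
    last by ring.
  by apply: (val_geB lfv) => //; do !apply: (val_ge0M lfv).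
have j0 : integral (p ^+ n * x0).
  rewrite (_ : p ^+ n * x0 = p ^+ n * (x0 + x1 * a2 + x2 * (a2 ^+ 2 + a1)) -
    (p ^+ n * x1 * a2 + p ^+ n * (x2 * (a2 ^+ 2 + a1)))); last by ring.
  apply: (val_geB lfv) => //; apply: (val_geD lfv); do ?apply: (val_ge0M lfv) => //.
  by apply: (val_geD lfv) => //; exact: val_geX.
exists (p ^+ n * x0), (p ^+ n * x1), x2; split=> //; first by alg_ring.
Qed.

End Tau.

(* [gen_dual g n] is homothetic to the dual of [gen_order g n] for [top_coef g];
   two nonzero functionals on [E] differ by a scalar of [E], so the class of the
   dual only depends on the order. *)
Lemma gen_dual_class (g g' : E) n : generator g -> generator g' -> gen_order g n = gen_order g' n ->
  exists2 u, u != 0 & forall z, gen_dual g' n z <-> gen_dual g n (u * z).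
Proof.
move=> gen gen' eR.
(* Agreement at the basis [1], [g], [g ^+ 2] turns [top_coef g'] into [top_coef g] of the multiple
   by [u]. *)
have [u [u0 u1 u2]] := top_coef_nondeg gen (top_coef g' 1) (top_coef g' g) (top_coef g' (g ^+ 2)).
have tr := trans_pow gen.
have tE x : top_coef g' x = top_coef g (u * x).
  have [x0 [x1 [x2 ->]]] := coord_ex x tr.
  rewrite !(top_coefD gen') !(top_coefZ gen') -u0 -u1 -u2 -!(top_coefZ gen) -!(top_coefD gen).
  by congr top_coef; alg_ring.
exists u.
  apply/eqP => u00; have := tE (0%:A + 0 *: g' + 1 *: g' ^+ 2).
  rewrite (top_coefE gen') u00 mul0r -[0 in RHS](_ : 0%:A + 0 *: g + 0 *: g ^+ 2 = 0); last first.
    by rewrite !scale0r !addr0.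
  by rewrite (top_coefE gen) => /eqP; rewrite oner_eq0.
move=> z; have ez : z = p ^+ n *: ((p ^+ n)^-1 *: z) by rewrite scalerA mulfV // scale1r.
have -> : u * z = p ^+ n *: (u * ((p ^+ n)^-1 *: z)) by rewrite {1}ez; alg_ring.
rewrite {1}ez -(top_coef_dual gen') -(top_coef_dual gen) -eR.
by split=> h y hy; [rewrite -mulrA -tE|rewrite tE mulrA]; apply: h.
Qed.

(** * Ideal classes *)

Lemma generator_ngen t a b : integral b -> generator (ngen t a b).
Proof.
move=> hb; split; rewrite ?ngen_neq0 // val_ngen //.
by rewrite -addrA dvd3D; case: t.
Qed.

Lemma ngenX t a n b : p ^+ n *: ngen t a b = ngen t (n + a) b.
Proof. by rewrite /ngen scalerA exprD. Qed.

(** Since [w (sig t) = 2 * w (rho t)], the last generators of the two lattices have equal valuation,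
    and [lattice_eqr] exchanges them. *)
Lemma nlattice_gen_order t a n b : integral b ->
  nlattice t (n + a) (n + 2 * a) b = gen_order (ngen t a b) n.
Proof.
move=> hb; rewrite /gen_order ngenX; have g0 := ngen_neq0 t a hb.
have g2 : ngen t a b ^+ 2 != 0 by rewrite expf_neq0.
apply: lattice_eqr; rewrite ?val_psig ?scaler_eq0 ?negb_or ?pX0 //.
- exact: trans_nlattice.
- by rewrite val_scale // vpX (dvalX lfw) // val_ngen //; lia.
- by rewrite val_ngen //; lia.
Qed.

Lemma nlattice_gen_dual t a n b : integral b ->
  nlattice t a (n + 2 * a) b = gen_dual (ngen t a b) n.
Proof.
move=> hb; have g0 := ngen_neq0 t a hb.
have g2 : ngen t a b ^+ 2 != 0 by rewrite expf_neq0.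
apply: lattice_eqr; rewrite ?val_psig ?scaler_eq0 ?negb_or ?pX0 //.
- exact: trans_nlattice.
- by rewrite val_scale // vpX (dvalX lfw) // val_ngen //; lia.
- by rewrite val_ngen //; lia.
Qed.

(** If [j <= 2 * i] the lattice is an order, equal to its multiplier ring. Otherwise it is the dual
    with [a = i] and [n = j - 2 * i], whose order has first index [n + a = j - i]. *)
Lemma multipliers_nlattice t i j b : integral b -> (i <= j)%N ->
  multipliers (nlattice t i j b) = nlattice t (maxn i (j - i)) j b.
Proof.
move=> hb ij; have [le|gt] := leqP j (2 * i).
  have -> : maxn i (j - i) = i by lia.
  have := nlattice_gen_order t (j - i) (2 * i - j) hb.
  have -> : (2 * i - j + (j - i) = i)%N by lia.
  have -> : (2 * i - j + 2 * (j - i) = j)%N by lia.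
  by move=> ->; apply/multipliers_gen_order/generator_ngen.
have -> : maxn i (j - i) = (j - 2 * i + i)%N by lia.
have ej : (j = j - 2 * i + 2 * i)%N by lia.
have := nlattice_gen_dual t i (j - 2 * i) hb; have := nlattice_gen_order t i (j - 2 * i) hb.
by rewrite -ej => -> ->; rewrite multipliers_gen_dual //; exact: generator_ngen.
Qed.

Lemma ideal_class_refl (M : set E) : ideal_class M M.
Proof.
exists 1; rewrite ?oner_neq0 // eqEsubset; split=> [x hx|_ [x hx <-]].
  by exists x; rewrite ?mul1r.
by rewrite mul1r.
Qed.

Lemma ideal_classP (M N : set E) : ideal_class M N <->
  exists2 u, u != 0 & forall z, N z <-> M (u * z).
Proof.
split=> [[u u0 ->]|[u u0 h]]; exists u^-1; rewrite ?invr_neq0 //.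
  by move=> z; split=> [[x hx <-]|hz]; [rewrite mulKf|exists (u^-1 * z); rewrite ?mulVKf].
rewrite eqEsubset; split=> [z /h hz|_ [x hx <-]]; first by exists (u * z); rewrite ?mulKf.
by apply/h; rewrite mulVKf.
Qed.

Lemma ideal_class_sym (M N : set E) : ideal_class M N -> ideal_class N M.
Proof.
move=> /ideal_classP[u u0 h]; apply/ideal_classP; exists u^-1; rewrite ?invr_neq0 //.
by move=> z; rewrite h mulVKf.
Qed.

Lemma ideal_class_trans (M N P : set E) :
  ideal_class M N -> ideal_class N P -> ideal_class M P.
Proof.
move=> /ideal_classP[u u0 h] /ideal_classP[u' u'0 h']; apply/ideal_classP.
by exists (u * u'); rewrite ?mulf_neq0 // => z; rewrite h' h mulrA.
Qed.

Lemma ideal_class_eq (M N : set E) : ideal_class M = ideal_class N <-> ideal_class M N.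
Proof.
split=> [->|MN]; first exact: ideal_class_refl.
rewrite eqEsubset; split=> P; apply: ideal_class_trans => //.
exact: ideal_class_sym.
Qed.

Lemma multipliers_class (M N : set E) : ideal_class M N -> multipliers M = multipliers N.
Proof.
move=> /ideal_classP[u u0 h]; rewrite eqEsubset; split=> x hx y.
  by rewrite !h mulrCA; apply: hx.
by have := hx (u^-1 * y); rewrite !h mulVKf // mulrCA mulVKf.
Qed.

(** Homothetic lattices share their multiplier ring, so the dual would be principal over its own. *)
Lemma order_not_dual t i j b t' i' j' b' : integral b -> integral b' ->
  (i <= j)%N -> (j <= 2 * i)%N -> (i' <= j')%N -> (2 * i' < j')%N ->
  ~ ideal_class (nlattice t i j b) (nlattice t' i' j' b').
Proof.
move=> hb hb' ij le ij' gt cl; have := multipliers_class cl.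
have em : maxn i (j - i) = i by lia.
rewrite (multipliers_nlattice t hb ij) em.
have ej : (j' = j' - 2 * i' + 2 * i')%N by lia.
have := nlattice_gen_dual t' i' (j' - 2 * i') hb'; rewrite -ej => eD.
move/ideal_classP: cl => [u u0]; rewrite eD multipliers_gen_dual; last exact: generator_ngen.
move=> h e; rewrite e in h.
have n0 : (0 < j' - 2 * i')%N by rewrite subn_gt0.
exact: (gen_dual_not_principal (generator_ngen t' i' hb') u0 n0 h).
Qed.

(** The invariants of a class are its multiplier ring and whether its members are homothetic to that
    ring. In the dual case the order recovers [i] as [j] minus its first index, and [gen_dual_class]
    shows that the order determines the class. *)
Lemma nlattice_classP t i j b t' i' j' b' : integral b -> integral b' ->
  (i <= j)%N -> (i' <= j')%N ->
  ideal_class (nlattice t i j b) (nlattice t' i' j' b') <->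
  nlattice t (maxn i (j - i)) j b = nlattice t' (maxn i' (j' - i')) j' b' /\
  (j <= 2 * i)%N = (j' <= 2 * i')%N.
Proof.
move=> hb hb' ij ij'; split=> [cl|[]].
  split; first by rewrite -!multipliers_nlattice //; exact: multipliers_class.
  have [le|gt] := leqP j (2 * i); have [le'|gt'] := leqP j' (2 * i') => //.
    by case: (order_not_dual hb hb' ij le ij' gt' cl).
  by case: (order_not_dual hb' hb ij' le' ij gt (ideal_class_sym cl)).
have [le|gt] := leqP j (2 * i) => e /esym.
  move=> le'; move: e; rewrite (_ : maxn i _ = i); last by lia.
  by rewrite (_ : maxn i' _ = i'); [move=> ->; exact: ideal_class_refl|lia].
move/negbT; rewrite -ltnNge => gt'; move: (e).
have m1 : (maxn i (j - i) <= j)%N by lia.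
have m2 : (maxn i' (j' - i') <= j')%N by lia.
move/(nlattice_eqP _ _ hb hb' m1 m2) => [et em ej _].
have ei : i' = i by lia.
subst t' j' i'; move: e; rewrite (_ : maxn i _ = (j - 2 * i) + i)%N; last by lia.
have {}ej : (j - 2 * i + 2 * i)%N = j by lia.
have := nlattice_gen_dual t i (j - 2 * i) hb; have := nlattice_gen_order t i (j - 2 * i) hb.
have := nlattice_gen_dual t i (j - 2 * i) hb'; have := nlattice_gen_order t i (j - 2 * i) hb'.
rewrite ej => -> -> -> -> e; apply/ideal_classP.
by have [u u0 h] := gen_dual_class (generator_ngen t i hb) (generator_ngen t i hb') e; exists u.
Qed.

(** * Orders and their fractional ideals in normal form *)

Section Order.
Variable R : set E.
Hypothesis ordR : is_order v R.

Lemma order1 : R 1.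
Proof. by case: ordR => -[h _ _] _ _ _; move: h; rewrite inE. Qed.

Lemma orderB x y : R x -> R y -> R (x - y).
Proof.
move=> hx hy; case: ordR => -[_ h _] _ _ _.
by have := h x y; rewrite !inE => /(_ hx hy).
Qed.

Lemma orderM x y : R x -> R y -> R (x * y).
Proof.
move=> hx hy; case: ordR => -[_ _ h] _ _ _.
by have := h x y; rewrite !inE => /(_ hx hy).
Qed.

Lemma orderD x y : R x -> R y -> R (x + y).
Proof.
move=> hx hy; rewrite -[y]opprK; apply: (orderB hx).
rewrite -sub0r; apply: orderB => //.
by rewrite -(subrr (1 : E)); apply: orderB; exact: order1.
Qed.

Lemma order_alg c : integral c -> R c%:A.
Proof. by move=> hc; case: ordR => _ h _ _; apply: h; exists c. Qed.

Lemma submodule_omod (I : set E) : submodule R I -> omod I.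
Proof.
case=> I0 ID IM; split=> // _ x [c hc <-]; apply: IM; exact: order_alg.
Qed.

Lemma submodule_order : submodule R R.
Proof.
split; [|exact: orderD|exact: orderM].
by rewrite -(subrr (1 : E)); apply: orderB; exact: order1.
Qed.

Lemma span_bounded (A : set E) (B : int) (s : seq E) :
  (forall x, A x -> val_ge w B x) ->
  exists B', forall x, lin_span A [set` s] x -> val_ge w B' x.
Proof.
move=> hA; have [B1 hB1] : exists B1, forall x, x \in s -> val_ge w B1 x.
  elim: s => [|y s [B1 IH]]; first by exists 0.
  exists (Num.min B1 (w y)) => x; rewrite inE => /orP[/eqP ->|/IH].
    by right; rewrite ge_min lexx orbT.
  by apply: val_ge_le; rewrite ge_min lexx.
exists (B + B1) => _ [n [a [g [ha hg ->]]]].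
by apply: (val_ge_sum lfw) => i; apply: (val_geM lfw); [exact: hA|exact/hB1/hg].
Qed.

Lemma order_bounded : exists B, forall x, R x -> val_ge w B x.
Proof.
case: ordR => _ _ [s es] _.
have [|B hB] := @span_bounded (base_ring v) 0 s.
  by move=> _ [c hc <-]; apply/val_ge_alg.
by exists B => x; rewrite [R]es; exact: hB.
Qed.

(** If [w x < 0], the powers of [x] have valuations unbounded below, whereas those on the finitely
    generated [R] are bounded. *)
Lemma order_integral : R `<=` valuation_ring w.
Proof.
have [B hB] := order_bounded => x hx; rewrite /valuation_ring.
have [->|x0] := eqVneq x 0; first exact: val_ge0.
right; rewrite leNgt; apply/negP => lt.
have hX n : R (x ^+ n).
  by elim: n => [|n IH]; [exact: order1|rewrite exprS; exact: orderM].
have := hB _ (hX `|B|.+1%N); move/(val_geP w _ (expf_neq0 _ x0)).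
rewrite (dvalX lfw) //; nia.
Qed.

Lemma order_full x : exists k : nat, R (p ^+ k *: x).
Proof.
have : [set: E] x by [].
case: ordR => _ _ _ <- [n [a [g [ha hg ->]]]].
have submodR := submodule_omod submodule_order.
have H (I : seq 'I_n) : exists k : nat, R (p ^+ k *: (\sum_(i <- I) a i * g i)).
  elim: I => [|i I [k IH]].
    by exists 0%N; rewrite big_nil scaler0; case: submodR.
  have [c _ ec] := ha i.
  exists (k + `|v c|)%N; rewrite big_cons scalerDr; apply: orderD; last first.
    by rewrite addnC exprD -scalerA; apply: (omodZ submodR).
  rewrite -ec mulr_algl scalerA; apply: (omodZ submodR) => //.
  have [->|c0] := eqVneq c 0; first by left; rewrite mulr0.
  by right; rewrite (dvalM lfv) // vpX; lia.
by have [k hk] := H (index_enum 'I_n); exists k.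
Qed.

Lemma multipliers_order : multipliers R = R.
Proof.
rewrite eqEsubset; split=> x hx; last by move=> y; exact: orderM.
by have := hx _ order1; rewrite mulr1.
Qed.

(** The inequality [j <= 2 * i] says that [R] is its own multiplier ring. *)
Lemma order_nlattice : exists t i j b,
  [/\ integral b, (i <= j)%N, (j <= 2 * i)%N & R = nlattice t i j b].
Proof.
have [t [i [j [b [hb ij eR]]]]] := lattice_normal_form (submodule_omod submodule_order)
  order1 order_integral order_full.
exists t, i, j, b; split=> //.
have := multipliers_order; rewrite eR multipliers_nlattice //.
have m : (maxn i (j - i) <= j)%N by lia.
by move=> /(nlattice_eqP _ _ hb hb m ij)[_ e _ _]; lia.
Qed.

Lemma fractional_ideal_nlattice t i j b : integral b -> (i <= j)%N ->
  R `<=` multipliers (nlattice t i j b) -> fractional_ideal R (nlattice t i j b).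
Proof.
move=> hb ij sub.
have [g1 g2 g3] := lattice_gen (ngen t i b) (p ^+ j *: sig t).
have oL := omod_lattice (ngen t i b) (p ^+ j *: sig t).
have subL : submodule R (nlattice t i j b).
  by case: oL => L0 LD _; split=> // a x /sub; apply.
split=> //; last first.
  by move=> e; move: g1; rewrite -/(nlattice t i j b) e => /eqP; rewrite oner_eq0.
exists [:: 1; ngen t i b; p ^+ j *: sig t].
rewrite eqEsubset; split=> [_ [c0 [c1 [c2 [h0 h1 h2 ->]]]]|_ [n [a [g [ha hg ->]]]]].
  exists 3%N, (fun k : 'I_3 => ([:: c0; c1; c2]`_k)%:A),
    (fun k : 'I_3 => [:: 1; ngen t i b; p ^+ j *: sig t]`_k).
  split=> [k|k|].
  - by apply: order_alg; case: k => [[|[|[|]]]].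
  - by rewrite /= mem_nth.
  - by rewrite !big_ord_recl big_ord0 /= addr0 !mulr_algl addrA.
case: subL => L0 LD LM; elim/big_ind: _ => // k _.
apply: LM => //; have := hg k; rewrite /= !inE.
by move=> /or3P[] /eqP ->.
Qed.

(** Division by an element [u] of least valuation makes the ideal contain 1, hence [R], and lie in
    the valuation ring. *)
Lemma fractional_ideal_normal_form (I : set E) : fractional_ideal R I ->
  exists t i j b, [/\ integral b, (i <= j)%N, R `<=` multipliers (nlattice t i j b) &
    ideal_class (nlattice t i j b) I].
Proof.
move=> [subI [s eI] nz].
have oI := submodule_omod subI.
have [B hB] : exists B, forall x, I x -> val_ge w B x.
  have [|B hB] := @span_bounded R 0 s; first exact: order_integral.
  by exists B => x; rewrite [I]eI; exact: hB.
have [m [Im m0]] : exists m, I m /\ m != 0.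
  apply: contrapT => h; apply: nz; rewrite eqEsubset.
  split=> [x hx|_ ->]; last by case: subI.
  by apply/eqP/negPn/negP => x0; apply: h; exists x.
have [||_ [u [Iu u0 <-]] min] :=
    @int_min (fun n => exists x, [/\ I x, x != 0 & w x = n]) B.
- by exists (w m), m.
- by move=> n [x [hx x0 <-]]; apply/(val_geP w B x0)/hB.
pose N := [set x | I (u * x)].
have clN : ideal_class N I.
  apply/ideal_classP; exists u^-1; rewrite ?invr_neq0 // => z.
  by rewrite /N /= mulVKf.
have IR x : R x -> I (x * u) by move=> hx; case: subI => _ _; apply.
have [||||t [i [j [b [hb ij eN]]]]] := @lattice_normal_form N.
- case: oI => I0 ID IM; split; rewrite /N /=; first by rewrite mulr0.
    by move=> x y; rewrite mulrDr; exact: ID.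
  by move=> a x ha hx; rewrite mulrCA; apply: IM.
- by rewrite /N /= mulr1.
- move=> x; rewrite /N /valuation_ring /= => hx.
  have [->|x0] := eqVneq x 0; first exact: val_ge0.
  right; have ux0 := mulf_neq0 u0 x0.
  have : w u <= w (u * x) by apply: min; exists (u * x).
  by rewrite (dvalM lfw) //; lia.
- by move=> x; have [k hk] := order_full x; exists k; rewrite /N /= mulrC; apply: IR.
exists t, i, j, b; rewrite -eN; split=> // x hx y; rewrite /N /= => hy.
by rewrite mulrCA; case: subI => _ _; apply.
Qed.

End Order.

(** * Colength and conductor *)

Lemma nlattice_integral t i j b : integral b -> (i <= j)%N ->
  nlattice t i j b `<=` valuation_ring w.
Proof.
move=> hb ij; apply: (lattice_least omod_ring).
- exact: val_ge1.
- by right; rewrite val_ngen //; lia.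
- by right; rewrite val_psig.
Qed.

Lemma nlattice_full t i j b x : integral b -> (i <= j)%N ->
  exists k : nat, nlattice t i j b (p ^+ k *: x).
Proof.
move=> hb ij; exists (`|w x| + j.+1)%N.
apply: (lattice_large (n := 3 * j.+1%:Z) (trans_nlattice t i j hb));
  rewrite ?val_ngen ?val_psig //; try by case: (t); lia.
have [->|x0] := eqVneq x 0; first by left; rewrite scaler0.
by right; rewrite val_scale // vpX; lia.
Qed.

(** Every member of a chain has a normal form, and [i + j + t] drops strictly along the chain. *)
Lemma chain_bound t i j b m : integral b -> (i <= j)%N ->
  quotient_chain (base_ring v) (nlattice t i j b) (valuation_ring w) m ->
  (m <= i + j + t)%N.
Proof.
move=> hb ij [C [hC ltC]].
have [L1 _ _] := lattice_gen (ngen t i b) (p ^+ j *: sig t).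
have nf k : (k <= m)%N -> exists t' i' j' b',
    [/\ integral b', (i' <= j')%N & C k = nlattice t' i' j' b'].
  move=> km; have [oC sub int] := hC _ km.
  apply: lattice_normal_form => //; first exact: sub.
  by move=> x; have [l hl] := nlattice_full t x hb ij; exists l; apply: sub.
suff H k : (k <= m)%N -> forall t' i' j' b', integral b' -> (i' <= j')%N ->
    C k = nlattice t' i' j' b' -> (i' + j' + t' + k <= i + j + t)%N.
  have [t' [i' [j' [b' [hb' ij' e]]]]] := nf m (leqnn m).
  by have := H m (leqnn m) _ _ _ _ hb' ij' e; lia.
elim: k => [km|k IH km] t1 i1 j1 b1 hb1 ij1 e.
  have [_ sub _] := hC _ km; rewrite addn0.
  by apply: (nlattice_size hb hb1 ij ij1); rewrite -e.
have [t' [i' [j' [b' [hb' ij' e']]]]] := nf k (ltnW km).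
have := IH (ltnW km) _ _ _ _ hb' ij' e'.
have := ltC _ km; rewrite e e' => /(nlattice_size_lt hb' hb1 ij' ij1).
by lia.
Qed.

Lemma chain_exists t i j b : integral b -> (i <= j)%N ->
  quotient_chain (base_ring v) (nlattice t i j b) (valuation_ring w) (i + j + t).
Proof.
move=> hb ij; move en : (i + j + t)%N => n.
elim: n t i j b hb ij en => [|n IH] t i j b hb ij en.
  exists (fun=> nlattice t i j b); split=> // k _.
  by split; [exact: omod_lattice| |exact: nlattice_integral].
(* One step up lowers [i + j + t] by 1: decrease [j] if [i < j]; if [i = j], pass from type 1 to
   type 0 with the same indices, or from type 0 to type 1 with both indices decreased. *)
have [t' [i' [j' [b' [hb' ij' en' cn]]]]] : exists (t' : bool) (i' j' : nat) b',
    [/\ integral b', (i' <= j')%N, (i' + j' + t' = n)%N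
      & contained t i j b t' i' j' b'].
  have [lt|ge] := ltnP i j.
    exists t, i, j.-1, b; split=> //; try lia.
    by rewrite /contained eqxx subrr; split=> //; [lia|left].
  have ej : j = i by lia.
  subst j; case: t en => en.
    exists false, i, i, 0; split=> //; try lia; first exact: val_ge0.
    by rewrite /contained /=; lia.
  exists true, i.-1, i.-1, 0; split=> //; try (rewrite /=; lia); first exact: val_ge0.
  by rewrite /contained /=; lia.
have sub : nlattice t i j b `<=` nlattice t' i' j' b' by apply/nlattice_contained.
have [C [hC ltC]] := IH _ _ _ _ hb' ij' en'.
exists (fun k => if k is k'.+1 then C k' else nlattice t i j b); split=> [[|k] hk|[|k] hk].
- by split; [exact: omod_lattice| |exact: nlattice_integral].
- by have [oC subC intC] := hC k hk; split=> // x /sub /subC.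
- have [_ subC _] := hC 0%N isT.
  rewrite properEneq; split; last by move=> x /sub /subC.
  apply/eqP => e; have : nlattice t' i' j' b' `<=` nlattice t i j b by rewrite e.
  by move=> /(nlattice_size hb' hb ij' ij); lia.
- exact: ltC.
Qed.

Lemma colength_nlattice t i j b s : integral b -> (i <= j)%N ->
  colength v w (nlattice t i j b) s -> s = (i + j + t)%N.
Proof.
move=> hb ij [ch bound]; apply/eqP; rewrite eqn_leq.
by rewrite (chain_bound hb ij ch) /= (bound _ (chain_exists t hb ij)).
Qed.

Lemma conductor_nlattice t i j b f : integral b -> (i <= j)%N ->
  conductor_exponent w piE (nlattice t i j b) f -> f = (3 * j + 2 * t)%N.
Proof.
move=> hb ij e.
have piX0 k : piE ^+ k != 0 by rewrite expf_neq0.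
have wpiX k : w (piE ^+ k) = k%:Z by rewrite (dvalX lfw) // wpi mulr1.
have large x : val_ge w (3 * j + 2 * t)%N x -> nlattice t i j b x.
  move=> hx; apply: (lattice_large (n := (3 * j + 2 * t)%N%:Z) (trans_nlattice t i j hb)) hx;
    rewrite ?val_ngen ?val_psig //; try lia.
have sub1 : (3 * j + 2 * t <= f)%N.
  rewrite leqNgt; apply/negP => lt.
  have [_ sub] : [set a | valuation_ring w a /\
      [set a * b0 | b0 in valuation_ring w] `<=` nlattice t i j b] (piE ^+ f).
    by rewrite e; exists 1; rewrite ?mulr1 //; exact: val_ge1.
  (* [x] has valuation [3 * j + 2 * t - 1] and the nonintegral coordinate [p^-1], so the lattice
     misses it. *)
  pose x := p^-1 *: (p ^+ j *: sig t).
  have x0 : x != 0 by rewrite scaler_eq0 negb_or invr_eq0 p0 psig_neq0.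
  have wx : w x = (3 * j%:Z - 1 + 2 * t%:Z).
    by rewrite val_scale ?invr_neq0 ?psig_neq0 // (dvalV lfv) // vp val_psig; lia.
  have : nlattice t i j b x.
    apply: sub; exists (x / piE ^+ f); last by rewrite mulrC divfK.
    by right; rewrite (dvalM lfw) ?invr_neq0 // (dvalV lfw) // wx wpiX; lia.
  rewrite (_ : x = 0%:A + 0 *: ngen t i b + p^-1 *: (p ^+ j *: sig t)); last first.
    by rewrite !scale0r !add0r.
  move=> /(latticeP _ _ _ (trans_nlattice t i j hb))[_ _].
  by move=> /(val_geP v 0 (invr_neq0 p0)); rewrite (dvalV lfv) // vp.
have sub2 : (f <= 3 * j + 2 * t)%N.
  have : [set a | valuation_ring w a /\
      [set a * b0 | b0 in valuation_ring w] `<=` nlattice t i j b] (piE ^+ (3 * j + 2 * t)).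
    split; first by right; rewrite wpiX.
    move=> _ [c hc <-]; apply: large.
    rewrite -[_%:Z]addr0; apply: (val_geM lfw) => //; right; rewrite wpiX; lia.
  rewrite e => -[c hc ec].
  have c0 : c != 0 by apply: contraTneq (piX0 (3 * j + 2 * t)%N) => c0; rewrite -ec c0 mulr0 eqxx.
  move/(val_geP w 0 c0): hc => hc.
  have := congr1 w ec; rewrite (dvalM lfw) // !wpiX; lia.
by apply/eqP; rewrite eqn_leq sub1 sub2.
Qed.

(* An index [(e, t, j, i)] stands for the overorders [nlattice t i j b]
   ([e = false]), or for the classes of their duals [nlattice t (j - i) j b]
   ([e = true], with [j < 2 * i] so that the dual is not principal). Containment
   of [nlattice t0 i0 j0 b0] leaves [q ^ freedom] values of [b]. *)
Definition class_index (i0 j0 : nat) := (bool * bool * 'I_j0.+1 * 'I_i0.+1)%type.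

Definition admissible (t0 : bool) (i0 j0 : nat) : pred (class_index i0 j0) :=
  fun u => let: (e, t, j, i) := u in
  [&& (i <= j)%N, (j + e <= 2 * i)%N & (t == t0) || (j + t <= i0)%N].

Definition freedom (i0 j0 : nat) (u : class_index i0 j0) : nat :=
  minn u.1.2 i0 - u.2.

Definition class_count (q : nat) (t0 : bool) (i0 j0 : nat) : nat :=
  (\sum_(u | @admissible t0 i0 j0 u) q ^ freedom u)%N.

Lemma card_ideal_class_monoid R q t0 i0 j0 b0 : is_order v R ->
  residue_field v #= `I_q -> integral b0 -> (i0 <= j0)%N ->
  R = nlattice t0 i0 j0 b0 -> ideal_class_monoid R #= `I_(class_count q t0 i0 j0).
Proof.
move=> ordR card_q hb0 ij0 eR.
have /choice[D hD] := reps_ex lfv up card_q.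
pose L := [seq (u, c) | u <- enum (@admissible t0 i0 j0), c <- D (freedom u)].
(* Containment puts [b - b0] in p^(j - i0), the subtraction truncating to 0 when [j <= i0]. As [b]
   matters modulo p^(j - i), the parameter [c] matters modulo p^(min(j, i0) - i), which is the
   exponent [freedom u]. *)
pose bv (u : class_index i0 j0) c := b0 + p ^+ (u.1.2 - i0) * c.
pose iv (u : class_index i0 j0) : nat := if u.1.1.1 then (u.1.2 - u.2)%N else u.2.
pose f (z : class_index i0 j0 * F) :=
  ideal_class (nlattice z.1.1.1.2 (iv z.1) z.1.1.2 (bv z.1 z.2)).
have memL e t (j : 'I_j0.+1) (i : 'I_i0.+1) c :
    (e, t, j, i, c) \in L -> let u := (e, t, j, i) in
    [/\ [/\ (i <= j)%N, (j + e <= 2 * i)%N & (t == t0) || (j + t <= i0)%N],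
    c \in D (minn j i0 - i)%N, integral (bv u c), (iv u <= j)%N &
    maxn (iv u) (j - iv u) = i /\ (j <= 2 * iv u)%N = ~~ e].
  move=> /allpairsPdep[u' [c' [hu hc [eu ec]]]] u.
  have {}hu : u \in enum (@admissible t0 i0 j0) by rewrite -[u]/(e, t, j, i) eu.
  rewrite -{}eu -{}ec {u' c'} in hc; move: hu; rewrite mem_enum => /and3P[ij je tt].
  split=> //; rewrite /iv /bv /=.
  - apply: (val_geD lfv) => //; apply: (val_ge0M lfv) => //.
    by have [_ _ h _ _] := hD (freedom (e, t, j, i)); exact: h.
  - by case: (e) => //; lia.
  - split; first by case: (e) je; lia.
    by case: (e) je => je; apply/idP/idP; lia.
have uL : uniq L.
  apply: allpairs_uniq_dep => [|u _|[u c] [u' c'] _ _ /= [-> ->]] //.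
    exact: enum_uniq.
  by have [] := hD (freedom u).
have fi : {in [set` L] &, injective f}.
  move=> [[[[e t] j] i] c] [[[[e' t'] j'] i'] c']; rewrite !inE => hL hL'.
  have /= [[ij je tt] hc hb ivj [mx par]] := memL _ _ _ _ _ hL.
  have /= [[ij' je' tt'] hc' hb' ivj' [mx' par']] := memL _ _ _ _ _ hL'.
  rewrite /f /= => /ideal_class_eq/(nlattice_classP _ _ hb hb' ivj ivj').
  rewrite mx mx' par par' => -[/(nlattice_eqP _ _ hb hb' ij ij')[et ei ej h] ee].
  have {}ee : e' = e by apply: negb_inj.
  have {}ej : j' = j by apply: val_inj.
  have {}ei : i' = i by apply: val_inj.
  subst e' t' j' i'; congr (_, _).
  have [_ _ _ _ inj] := hD (minn j i0 - i)%N; apply/esym/inj => //.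
  move: h; rewrite /bv /= (_ : _ - _ = p ^+ (j - i0) * (c' - c)); last by ring.
  rewrite (val_geMl lfv) // vpX; apply: val_ge_le.
  by move: (ltn_ord i); lia.
suff -> : ideal_class_monoid R = f @` [set` L].
  apply: card_eq_trans (inj_card_eq fi) _.
  rewrite (_ : class_count q t0 i0 j0 = size L); first exact: card_uniq_seq.
  rewrite size_allpairs_dep sumnE big_map big_enum_cond /= /class_count.
  by apply: eq_big => [u|u _]; rewrite ?andbT //; have [-> _] := hD (freedom u).
rewrite eqEsubset; split; last first.
  move=> _ [[[[[e t] j] i] c] hL <-].
  have /= [[ij je tt] hc hb ivj [mx par]] := memL _ _ _ _ _ hL.
  rewrite /f /=; eexists; last reflexivity.
  apply: (fractional_ideal_nlattice ordR) => //; rewrite multipliers_nlattice // mx eR.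
  apply/nlattice_contained => //; rewrite /contained eq_sym.
  case: eqP tt => //= _ _; split; try by rewrite -ltnS.
  have [_ _ Dint _ _] := hD (minn j i0 - i)%N.
  rewrite /bv /= addrAC subrr add0r (val_geMl lfv) // vpX.
  by apply: val_ge_le (Dint _ hc); lia.
move=> _ [I fI <-].
have [t [i' [j [b [hb ij sub cl]]]]] := fractional_ideal_normal_form ordR fI.
set i := maxn i' (j - i').
have mxj : (i <= j)%N by rewrite /i; lia.
move: sub; rewrite multipliers_nlattice // eR => /(nlattice_contained _ _ hb0 hb ij0 mxj) ct.
(* [e] records the dual case, in which [i = j - i']. *)
pose e := (2 * i' < j)%N.
have je : (j + e <= 2 * i)%N by rewrite /e /i; case: ltnP; lia.
have ei' : (if e then (j - i)%N else i) = i' by rewrite /e /i; case: ltnP; lia.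
have [ltj lti tt hval] : [/\ (j < j0.+1)%N, (i < i0.+1)%N, (t == t0) || (j + t <= i0)%N
    & integral ((b - b0) / p ^+ (j - i0))].
  move: ct; rewrite /contained eq_sym; case: eqP => [_ [h1 h2 h3]|_ h] /=; split=> //; try lia.
    apply/val_ge_pdiv; have [le|gt] := leqP i0 j.
      by apply: val_ge_le h3; lia.
    by apply: (val_ge_le _ (val_geB lfv hb hb0)); lia.
  have -> : (j - i0 = 0)%N by lia.
  by rewrite expr0 divr1; apply: (val_geB lfv).
pose u : class_index i0 j0 := (e, t, Ordinal ltj, Ordinal lti).
have [_ _ Dint Dsurj _] := hD (freedom u).
have [c hc hcv] := Dsurj _ hval.
have hL : (u, c) \in L.
  by apply/allpairsPdep; exists u, c; split=> //; rewrite mem_enum; apply/and3P; split.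
exists (u, c) => //.
have /= [_ _ hbv ivj [mx par]] := memL _ _ _ _ _ hL.
apply/ideal_class_eq; apply: ideal_class_trans cl.
apply/nlattice_classP => //; rewrite mx par; split; last first.
  by rewrite /e; apply/idP/idP; lia.
apply/nlattice_eqP => //; split=> //.
rewrite /bv /= (_ : _ - _ = p ^+ (j - i0) * ((b - b0) / p ^+ (j - i0) - c)); last first.
  by field; exact: pX0.
rewrite (val_geMl lfv) // vpX; apply: val_ge_le hcv.
rewrite /freedom /u /=; lia.
Qed.

End CubicExtension.

(** * Closed form of the count *)

Section ClosedForm.
Variable q : nat.
Local Notation Q := (q%:R : rat).

(** Telescoping; by truncated subtraction both sides vanish on an empty interval. *)
Lemma geometric_interval (lo hi m : nat) :
  (Q - 1) * \sum_(i < m | (lo <= i)%N && (i <= hi)%N) Q ^+ (hi - i) =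
  Q ^+ (hi.+1 - lo) - Q ^+ (hi.+1 - maxn lo m).
Proof.
elim: m => [|m IH]; first by rewrite big_ord0 maxn0 subrr mulr0.
rewrite big_mkcond big_ord_recr /= -big_mkcond mulrDr IH /=.
have [lom|mlo] /= := leqP lo m; last first.
  rewrite mulr0 addr0; congr (_ - _ ^+ _); lia.
have [mhi|him] := leqP m hi; last first.
  by rewrite mulr0 addr0; congr (_ - _ ^+ _); lia.
rewrite (maxn_idPr (leqW lom)) subSS (subSn mhi) exprS.
by ring.
Qed.

(** This is [Q - 1] times the sum over [i] for fixed [e], [t], [j]; [uphalf (j + e)] is the least
    [i] with [j + e <= 2 * i]. *)
Definition layer (i0 e j : nat) : rat := Q ^+ ((minn j i0).+1 - uphalf (j + e)) - 1.

Lemma class_count_layers t0 i0 j0 :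
  (Q - 1) * (class_count q t0 i0 j0)%:R =
  \sum_(t : bool) \sum_(j < j0.+1 | (t == t0) || (j + t <= i0)%N)
    (layer i0 0 j + layer i0 1 j).
Proof.
have -> : (class_count q t0 i0 j0)%:R = \sum_(e : bool) \sum_(t : bool)
    \sum_(j < j0.+1) \sum_(i < i0.+1 | @admissible t0 i0 j0 (e, t, j, i))
      Q ^+ (minn j i0 - i).
  rewrite pair_big pair_big /= pair_big_dep /= /class_count natr_sum.
  by apply: eq_big => [[[[e t] j] i]|[[[e t] j] i] _] //; rewrite natrX.
rewrite mulr_sumr.
under eq_bigr => e _ do rewrite mulr_sumr.
rewrite exchange_big /=; apply: eq_bigr => t _.
under eq_bigr => e _ do rewrite mulr_sumr.
rewrite exchange_big /= [RHS]big_mkcond /=; apply: eq_bigr => j _.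
case: ifP => tj; last first.
  rewrite big1 // => e _; rewrite big_pred0 ?mulr0 // => i.
  by rewrite !andbF.
have H (e : bool) : (Q - 1) * (\sum_(i < i0.+1 | [&& (i <= j)%N, (j + e <= 2 * i)%N & true])
    Q ^+ (minn j i0 - i)) = layer i0 e j.
  rewrite (eq_bigl (fun i : 'I_i0.+1 => (uphalf (j + e) <= i)%N && (i <= minn j i0)%N)).
    rewrite geometric_interval /layer; congr (_ - _).
    by rewrite (_ : (_ - _ = 0)%N) ?expr0 //; lia.
  move=> i; rewrite andbT.
  by have hi := ltn_ord i; apply/idP/idP; lia.
by rewrite big_bool !H addrC.
Qed.

(** For [j <= i0] the minimum is [j], so the exponents grow like j/2 and the sum depends on the
    parity of [m]. *)
Lemma low_layers i0 m : (m <= i0.+1)%N ->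
  (Q - 1) * \sum_(j < m) (layer i0 0 j + layer i0 1 j) =
  (if odd m then Q ^+ m./2 * (Q ^+ 2 + 3 * Q) else Q ^+ m./2 * (3 * Q + 1)) -
  (3 * Q + 1) - 2 * m%:R * (Q - 1).
Proof.
elim: m => [|m IH] mi; first by rewrite big_ord0 /=; ring.
rewrite big_ord_recr mulrDr IH 1?ltnW //= /layer (minn_idPl _) // addn0 addn1.
have [odm|evm] := boolP (odd m).
  have -> : (m.+1 - uphalf m = m./2.+1)%N by lia.
  have -> : (m.+1 - uphalf m.+1 = m./2.+1)%N by lia.
  have -> : (uphalf m = m./2.+1)%N by lia.
  by rewrite /= -(natr1 m) (exprS _ m./2); ring.
have -> : (m.+1 - uphalf m = m./2.+1)%N by lia.
have -> : (m.+1 - uphalf m.+1 = m./2)%N by lia.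
have -> : (uphalf m = m./2)%N by lia.
by rewrite /= -(natr1 m) (exprS _ m./2); ring.
Qed.

(** A function whose decrements in [j] give the layers above [i0]. Its value at [j0] yields the last
    two powers of [Q] in the formulas. *)
Definition tail_term (i0 j : nat) : rat :=
  Q ^+ (i0 - j./2) * (if odd j then Q + 3 else 3 * Q + 1).

(** For [j > i0] the minimum is [i0], so the exponents fall as [j] grows and the sum telescopes. *)
Lemma high_layers i0 d : (d <= i0)%N ->
  (Q - 1) * \sum_(j < d) (layer i0 0 (i0.+1 + j) + layer i0 1 (i0.+1 + j)) =
  tail_term i0 i0 - tail_term i0 (i0 + d) - 2 * d%:R * (Q - 1).
Proof.
elim: d => [|d IH] di; first by rewrite big_ord0 addn0; ring.
rewrite big_ord_recr mulrDr IH 1?ltnW //=.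
rewrite /layer (minn_idPr _) 1?leqW ?leq_addr // addn0 addn1 addnS addSn.
move: (tail_term i0 i0) => T; rewrite /tail_term /=.
have [odn|evn] := boolP (odd (i0 + d)).
  have -> : (i0.+1 - uphalf (i0 + d).+1 = (i0 - uphalf (i0 + d)).+1)%N by lia.
  have -> : (i0.+1 - uphalf (i0 + d).+2 = i0 - uphalf (i0 + d))%N by lia.
  have -> : (i0 - (i0 + d)./2 = (i0 - uphalf (i0 + d)).+1)%N by lia.
  by rewrite /= -(natr1 d) (exprS _ (i0 - uphalf (i0 + d))); ring.
have -> : (i0.+1 - uphalf (i0 + d).+1 = i0 - (i0 + d)./2)%N by lia.
have -> : (i0.+1 - uphalf (i0 + d).+2 = i0 - (i0 + d)./2)%N by lia.
have -> : (uphalf (i0 + d) = (i0 + d)./2)%N by lia.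
by rewrite /= -(natr1 d); ring.
Qed.

(** Collects the growing parts of the low layers of both types and the boundary value
    [tail_term i0 i0]. *)
Definition main_term (t : bool) (i0 : nat) : rat := Q ^+ i0./2 *
  match t, odd i0 with
  | false, false => Q ^+ 2 + 9 * Q + 2
  | false, true => 5 * Q ^+ 2 + 7 * Q
  | true, false => 2 * Q ^+ 2 + 9 * Q + 1
  | true, true => 7 * Q ^+ 2 + 5 * Q
  end.

(** Type [t0] contributes all [j <= j0], the other type only low layers with [j + t <= i0]. There
    are [i0 + j0 + t0 + 1] pairs of [t] and [j], which gives the linear term. One factor [Q - 1]
    serves the sum over [i], the other the sum over [j]. *)
Lemma class_count_closed t0 i0 j0 : (i0 <= j0)%N -> (j0 <= 2 * i0)%N ->
  (Q - 1) ^+ 2 * (class_count q t0 i0 j0)%:R =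
  main_term t0 i0 + 2 * (i0 + j0 + t0)%:R * (1 - Q) - 8 * Q - tail_term i0 j0.
Proof.
move=> ij ji; rewrite expr2 -mulrA class_count_layers.
have [d ej] : exists d, j0 = (i0 + d)%N by exists (j0 - i0)%N; lia.
have di : (d <= i0)%N by lia.
subst j0.
have same : \sum_(j < (i0 + d).+1) (layer i0 0 j + layer i0 1 j) =
    \sum_(j < i0.+1) (layer i0 0 j + layer i0 1 j) +
    \sum_(j < d) (layer i0 0 (i0.+1 + j) + layer i0 1 (i0.+1 + j)).
  by rewrite -addSn big_split_ord.
have other k : (k <= 1)%N ->
    \sum_(j < (i0 + d).+1 | (j + k <= i0)%N) (layer i0 0 j + layer i0 1 j) =
    \sum_(j < i0.+1 - k) (layer i0 0 j + layer i0 1 j).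
  move=> k1; rewrite (big_ord_widen (i0 + d).+1 (fun j : nat => layer i0 0 j + layer i0 1 j)).
    by apply: eq_bigl => j; lia.
  by lia.
have low0 := low_layers (leqnn i0.+1); have low1 := low_layers (leqnSn i0).
have high := high_layers di.
rewrite big_bool; case: t0 => /=; rewrite same other //= ?subn0 ?subn1 /=.
all: rewrite ![in LHS]mulrDr high low0 ?low1 -(natr1 i0) /main_term.
all: rewrite ?addn0 ?addn1 -?(natr1 (i0 + (i0 + d))) !natrD.
all: move: (tail_term i0 (i0 + d)) => T; rewrite /tail_term /=.
all: have [odi|evi] := boolP (odd i0).
all: try have -> : uphalf i0 = i0./2.+1 by lia.
all: try have -> : (i0 - i0./2 = i0./2.+1)%N by lia.
all: try have -> : uphalf i0 = i0./2 by lia.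
all: try have -> : (i0 - i0./2 = i0./2)%N by lia.
all: by rewrite /= ?(exprS _ i0./2); ring.
Qed.

(** * From the closed form to the stated formulas *)

Hypothesis q_gt1 : (1 < q)%N.

Let Q0 : Q != 0. Proof. by rewrite pnatr_eq0; lia. Qed.
Let Q1 : Q - 1 != 0. Proof. by rewrite subr_eq0 (eqr_nat _ q 1); lia. Qed.

(** The stated fractions are the closed form expanded by a power of [Q], which clears the negative
    exponents. *)
Lemma solve_count (C N T : rat) k : (Q - 1) ^+ 2 * C = T -> Q ^+ k * T = N ->
  C = N / (Q ^+ k * (Q - 1) ^+ 2).
Proof.
move=> <- <-; apply: (canRL (mulfK _)); last by ring.
by rewrite mulf_neq0 ?expf_neq0.
Qed.

Lemma class_count_3f i0 j0 : (i0 <= j0)%N -> (j0 <= 2 * i0)%N ->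
  (class_count q false i0 j0)%:R = card_formula_3f q (i0 + j0) (3 * j0).
Proof.
move=> ij ji; have := class_count_closed false ij ji.
rewrite addn0 /card_formula_3f mulKn // oddD.
rewrite (_ : (i0 + j0)%:Z - _ = i0%:Z); last by lia.
rewrite -(PoszD i0 1) -!exprnP /main_term /tail_term.
(* As [j0 <= 2 * i0] the subtraction is exact; it relates the exponent in [tail_term] to the power
   [Q ^+ i0] of the formula. *)
have er : i0 = (j0./2 + (i0 - j0./2))%N by lia.
have eQ : Q ^+ i0 = Q ^+ j0./2 * Q ^+ (i0 - j0./2) by rewrite -exprD -er.
have eQ1 : Q ^+ (i0 + 1) = Q ^+ j0./2 * Q ^+ (i0 - j0./2) * Q by rewrite -eQ addn1 exprSr.
move: (i0 - j0./2)%N eQ eQ1 {er} => r -> ->.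
have [odj|evj] := boolP (odd j0); have [odi|evi] := boolP (odd i0) => /=;
  move=> /solve_count; apply.
- have -> : ((3 * j0 - 3) %/ 6 = j0./2)%N by lia.
  have -> : ((3 * j0 + 3) %/ 6 = j0./2 + 1)%N by lia.
  have -> : ((i0 + j0) %/ 2 = i0./2 + j0./2 + 1)%N by lia.
  by rewrite !exprD; ring.
- have -> : ((3 * j0 - 3) %/ 6 = j0./2)%N by lia.
  have -> : ((3 * j0 + 3) %/ 6 = j0./2 + 1)%N by lia.
  have -> : ((i0 + j0 + 3) %/ 2 = i0./2 + j0./2 + 2)%N by lia.
  have -> : ((i0 + j0 + 1) %/ 2 = i0./2 + j0./2 + 1)%N by lia.
  have -> : ((i0 + j0 - 1) %/ 2 = i0./2 + j0./2)%N by lia.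
  by rewrite !exprD; ring.
- have -> : ((3 * j0) %/ 6 = j0./2)%N by lia.
  have -> : ((i0 + j0 + 3) %/ 2 = i0./2 + j0./2 + 2)%N by lia.
  have -> : ((i0 + j0 + 1) %/ 2 = i0./2 + j0./2 + 1)%N by lia.
  by rewrite !exprD; ring.
- have -> : ((3 * j0) %/ 6 = j0./2)%N by lia.
  have -> : ((i0 + j0) %/ 2 = i0./2 + j0./2)%N by lia.
  by rewrite !exprD; ring.
Qed.

Lemma class_count_3f1 i0 j0 : (i0 <= j0)%N -> (j0 <= 2 * i0)%N ->
  (class_count q true i0 j0)%:R = card_formula_3f1 q (i0 + j0 + 1) (3 * j0 + 2).
Proof.
move=> ij ji; have := class_count_closed true ij ji.
rewrite /card_formula_3f1 !oddD /= (_ : (3 * j0 + 2 + 1) %/ 3 = j0.+1)%N; last by lia.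
rewrite oddS (_ : (i0 + j0 + 1)%:Z - _ = i0%:Z); last by lia.
rewrite -(PoszD i0 1) -(PoszD i0 2) -!exprnP /main_term /tail_term.
have er : i0 = (j0./2 + (i0 - j0./2))%N by lia.
have eQ : Q ^+ i0 = Q ^+ j0./2 * Q ^+ (i0 - j0./2) by rewrite -exprD -er.
have eQ1 : Q ^+ (i0 + 1) = Q ^+ j0./2 * Q ^+ (i0 - j0./2) * Q by rewrite -eQ addn1 exprSr.
have eQ2 : Q ^+ (i0 + 2) = Q ^+ j0./2 * Q ^+ (i0 - j0./2) * Q ^+ 2 by rewrite -eQ exprD.
move: (i0 - j0./2)%N eQ eQ1 eQ2 {er} => r -> -> ->.
have [odj|evj] := boolP (odd j0); have [odi|evi] := boolP (odd i0) => /=;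
  move=> /solve_count; apply.
- have -> : ((3 * j0 + 2 + 1) %/ 6 = j0./2 + 1)%N by lia.
  have -> : ((i0 + j0 + 1 + 3) %/ 2 = i0./2 + j0./2 + 3)%N by lia.
  have -> : ((i0 + j0 + 1 + 1) %/ 2 = i0./2 + j0./2 + 2)%N by lia.
  by rewrite !exprD; ring.
- have -> : ((3 * j0 + 2 + 1) %/ 6 = j0./2 + 1)%N by lia.
  have -> : ((i0 + j0 + 1) %/ 2 = i0./2 + j0./2 + 1)%N by lia.
  by rewrite !exprD; ring.
- have -> : ((3 * j0 + 2 - 2) %/ 6 = j0./2)%N by lia.
  have -> : ((3 * j0 + 2 + 4) %/ 6 = j0./2 + 1)%N by lia.
  have -> : ((i0 + j0 + 1) %/ 2 = i0./2 + j0./2 + 1)%N by lia.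
  by rewrite !exprD; ring.
- have -> : ((3 * j0 + 2 - 2) %/ 6 = j0./2)%N by lia.
  have -> : ((3 * j0 + 2 + 4) %/ 6 = j0./2 + 1)%N by lia.
  have -> : ((i0 + j0 + 1 + 3) %/ 2 = i0./2 + j0./2 + 2)%N by lia.
  have -> : ((i0 + j0 + 1 + 1) %/ 2 = i0./2 + j0./2 + 1)%N by lia.
  have -> : ((i0 + j0 + 1 - 1) %/ 2 = i0./2 + j0./2)%N by lia.
  by rewrite !exprD; ring.
Qed.
End ClosedForm.

(** Quantifying [N] before the fields and the order expresses that the count depends only on [s],
    [f] and [q]. *)
Theorem theorem4p12 :
  exists N : nat -> nat -> nat -> nat,
  forall (F : fieldType) (v : F -> int) (E : fieldExtType F) (w : E -> int)
    (piE : E) (R : set E) (q s f : nat),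
  local_field v ->
  local_field w ->
  \dim {:E} = 3%N ->
  totally_ramified v w ->
  residue_field v #= `I_q ->
  uniformizer w piE ->
  is_order v R ->
  colength v w R s ->
  conductor_exponent w piE R f ->
  [/\ ideal_class_monoid R #= `I_(N s f q),
      (3 %| f)%N -> (N s f q)%:R = card_formula_3f q s f
    & (3 %| f + 1)%N -> (N s f q)%:R = card_formula_3f1 q s f].
Proof.
(* The orders [nlattice t i j b] have [s = i + j + t] and [f = 3 * j + 2 * t]. *)
exists (fun s f q =>
  class_count q (f %% 3 == 2) (s - f %/ 3 - (f %% 3 == 2)) (f %/ 3))%N.
move=> F v E w piE R q s f lfv lfw dimE ramE card_q uE ordR lenR condR.
have [p p0 vp] := local_val1 lfv; have up : uniformizer v p by [].
have [t [i [j [b [hb ij ji eR]]]]] := order_nlattice lfv lfw dimE ramE up uE ordR.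
rewrite eR in lenR condR.
have es := colength_nlattice lfv lfw dimE ramE up uE hb ij lenR.
have ef := conductor_nlattice lfv lfw dimE ramE up uE hb ij condR.
cbv beta; have -> : (f %% 3 == 2)%N = t by rewrite ef; case: (t) => /=; lia.
have -> : (f %/ 3 = j)%N by rewrite ef; case: (t) => /=; lia.
have -> : (s - j - t = i)%N by lia.
have q1 := residue_gt1 lfv card_q.
split.
- exact: (card_ideal_class_monoid lfv lfw dimE ramE up uE ordR card_q hb ij eR).
- rewrite es ef; case: (t) => /= div3; first by exfalso; lia.
  by rewrite !addn0; apply: class_count_3f.
- rewrite es ef; case: (t) => /= div3; last by exfalso; lia.
  by rewrite muln1; apply: class_count_3f1.
Qed.
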